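(* Let $r$ be a $d$-variate tail copula density and let $I,J\subset[d]$ be non-empty and disjoint. For $x_J\in(0,\infty)^J$ such that $0<r_J(x_J)<\infty$, the function $x_I\mapsto r_{I|J}(x_I|x_J)$ is a probability density on $(0,\infty)^I$. For $i\in I$, its $i$-th marginal probability density is $x_i\mapsto r_{i|J}(x_i|x_J)$, with cumulative distribution function $x_i\mapsto R_{i|J}(x_i|x_J):=\int_0^{x_i}r_{i|J}(t|x_J)\,dt$ and quantile function $u_i\mapsto R_{i|J}^{-1}(u_i|x_J)$. If $|I|\ge2$, then the copula density of $r_{I|J}(\cdot\,|x_J)$ is $$c_{I;J}(u_I;x_J):=\frac{r_{I|J}(x_I|x_J)}{\prod_{i\in I}r_{i|J}(x_i|x_J)}\quad\text{with } x_i=R_{i|J}^{-1}(u_i|x_J),\qquad u_I\in(0,1)^I.$$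
   Context: $[d]=\{1,\dots,d\}$, $x_J=(x_j)_{j\in J}$; in subscripts $i$ stands for $\{i\}$. A $d$-variate tail copula density is a Borel measurable function $r:(0,\infty)^d\to[0,\infty)$ such that (a) $\int_{(0,\infty)^{d-1}} r(x)\,dx_{[d]\setminus\{j\}}=1$ for every $j\in[d]$ and $x_j\in(0,\infty)$, and (b) $r(sx)=s^{1-d}r(x)$ for all $s>0$, $x\in(0,\infty)^d$. For non-empty $J\subseteq[d]$, $r_J(x_J)=\int r(x)\,dx_{[d]\setminus J}\in[0,\infty]$ (with $r_{[d]}=r$). For disjoint non-empty $I,J$ and $x_J$ with $0<r_J(x_J)<\infty$, $r_{I|J}(x_I|x_J)=r_{I\cup J}(x_{I\cup J})/r_J(x_J)$. The quantile function of a distribution function $F$ is $F^{-1}(u)=\inf\{y:F(y)\ge u\}$. The copula density of an absolutely continuous probability distribution is the density of its copula, as an almost-everywhere defined function; the displayed ratio is set to $0$ where its denominator is $0$ or a term is infinite. *)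

(* Defs.v *)
From HB Require Import structures.
From mathcomp Require Import all_boot all_order all_algebra.
From mathcomp Require Import all_classical all_reals all_analysis.
From mathcomp Require Import measurable_realfun.

Set Implicit Arguments.
Unset Strict Implicit.
Unset Printing Implicit Defensive.

Import Order.TTheory GRing.Theory Num.Theory.
Import numFieldNormedType.Exports.

Local Open Scope classical_set_scope.
Local Open Scope ring_scope.

Definition ffun_display : measure_display -> measure_display.
Proof. exact. Qed.

Section measurable_ffun.
Context {d} (T : finType) (V : measurableType d).

HB.instance Definition _ :=
  isPointed.Build {ffun T -> V} [ffun=> point].

(* The product sigma-algebra; for [V = R] it is the Borel sigma-algebra of
   [R^T]. *)
Definition ffun_measurable : set (set {ffun T -> V}) :=
  <<s \bigcup_t preimage_set_system setT
        (fun x : {ffun T -> V} => x t) measurable >>.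

Let ffun_measurable0 : ffun_measurable set0.
Proof. exact: sigma_algebra0. Qed.

Let ffun_measurableC A : ffun_measurable A -> ffun_measurable (~` A).
Proof. exact: sigma_algebraC. Qed.

Let ffun_measurable_bigcup (F : (set {ffun T -> V})^nat) :
  (forall i, ffun_measurable (F i)) -> ffun_measurable (\bigcup_i (F i)).
Proof. exact: sigma_algebra_bigcup. Qed.

HB.instance Definition _ := @isMeasurable.Build (ffun_display d)
  {ffun T -> V} ffun_measurable
  ffun_measurable0 ffun_measurableC ffun_measurable_bigcup.

Lemma measurable_ffun_app (t : T) :
  measurable_fun [set: {ffun T -> V}] (fun x : {ffun T -> V} => x t).
Proof.
move=> _ Y mY; apply: sub_sigma_algebra; exists t => //.
by exists Y.
Qed.

Lemma measurable_to_ffun d' (X : measurableType d') (f : X -> {ffun T -> V}) :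
  (forall t, measurable_fun [set: X] (fun x => f x t)) ->
  measurable_fun [set: X] f.
Proof.
move=> mf.
apply: (@measurability _ _ _ _ _ _
  (\bigcup_t preimage_set_system setT (fun x : {ffun T -> V} => x t)
    measurable)) => //.
move=> _ [_ [t _ [Y mY <-]] <-].
have := mf t measurableT Y mY.
by rewrite !setTI.
Qed.

End measurable_ffun.

Lemma product_measure1_sigma_finite d1 d2 (X : measurableType d1)
    (Y : measurableType d2) (R : realType)
    (m1 : {sigma_finite_measure set X -> \bar R})
    (m2 : {sigma_finite_measure set Y -> \bar R}) :
  sigma_finite [set: X * Y] (m1 \x m2)%E.
Proof.
have /sigma_finiteP[F [TF ndF Foo]] := sigma_finiteT m1.
have /sigma_finiteP[G [TG ndG Goo]] := sigma_finiteT m2.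
exists (fun n => F n `*` G n).
  rewrite -setXTT TF TG predeqE => -[x y]; split.
    move=> [/= [n _ Fnx] [k _ Gky]]; exists (maxn n k) => //; split.
    - by move: x Fnx; exact/subsetPset/ndF/leq_maxl.
    - by move: y Gky; exact/subsetPset/ndG/leq_maxr.
  by move=> [n _ []/= ? ?]; split; exists n.
move=> k; have [? ?] := Foo k; have [? ?] := Goo k.
split; first exact: measurableX.
by rewrite product_measure1E// lte_mul_pinfty// ge0_fin_numE.
Qed.

(* Product measures need sigma-finiteness, which a pushforward inherits along
   a map with a measurable left inverse. *)
Section push_sigma_finite.
Context d1 d2 (X : measurableType d1) (Y : measurableType d2) (R : realType).
Variables (m : {measure set X -> \bar R}) (f : X -> Y) (g : Y -> X).
Hypothesis sm : sigma_finite [set: X] m.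
Hypotheses (mf : measurable_fun [set: X] f) (mg : measurable_fun [set: Y] g).
Hypothesis fK : cancel f g.


Let push : set Y -> \bar R := pushforward m f.

Let push0 : push set0 = 0%E. Proof. exact: measure0. Qed.

Let push_ge0 A : (0 <= push A)%E. Proof. exact: measure_ge0. Qed.

Let push_sigma_additive : semi_sigma_additive push.
Proof.
exact: (@measure_semi_sigma_additive _ _ _
  (measure_function_pushforward__canonical__measure_function_Measure m mf)).
Qed.

HB.instance Definition _ := isMeasure.Build _ _ _
  push push0 push_ge0 push_sigma_additive.

Let push_sigma_finite : sigma_finite [set: Y] push.
Proof.
have [F FT Foo] := sm.
exists (fun n => g @^-1` F n); first by rewrite -preimage_bigcup -FT.
move=> n; have [mF moo] := Foo n; split.
  by rewrite -[X in measurable X]setTI; exact: mg.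
rewrite /push /pushforward (_ : f @^-1` _ = F n)//.
by apply/seteqP; split=> x /=; rewrite fK.
Qed.

HB.instance Definition _ := Measure_isSigmaFinite.Build _ _ _
  push push_sigma_finite.

Definition pushforward_sf : {sigma_finite_measure set Y -> \bar R} := push.

Lemma pushforward_sfE A : pushforward_sf A = m (f @^-1` A).
Proof. by []. Qed.

End push_sigma_finite.

Section lebesgue_ffun.
Variable R : realType.

Definition ffun_cons n (x : measurableTypeR R * {ffun 'I_n -> R}) :
    {ffun 'I_n.+1 -> R} :=
  [ffun i => if unlift ord0 i is Some j then x.2 j else x.1].

Definition ffun_uncons n (x : {ffun 'I_n.+1 -> R}) :
    measurableTypeR R * {ffun 'I_n -> R} :=
  (x ord0, [ffun j => x (lift ord0 j)]).

Lemma ffun_consK n : cancel (@ffun_cons n) (@ffun_uncons n).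
Proof.
move=> [a x]; rewrite /ffun_uncons /ffun_cons ffunE unlift_none/=.
by congr pair; apply/ffunP => j; rewrite !ffunE liftK.
Qed.

Lemma measurable_ffun_cons n : measurable_fun setT (@ffun_cons n).
Proof.
apply: measurable_to_ffun => i.
case: (unliftP ord0 i) => [j ->|->].
  rewrite (_ : (fun _ => _) = (fun x : {ffun 'I_n -> R} => x j) \o snd).
    by apply: measurableT_comp => //; exact: measurable_ffun_app.
  by apply/funext => x; rewrite /= ffunE liftK.
rewrite (_ : (fun _ => _) = fst); first exact: measurable_fst.
by apply/funext => x; rewrite /= ffunE unlift_none.
Qed.

Lemma measurable_ffun_uncons n : measurable_fun setT (@ffun_uncons n).
Proof.
apply: measurable_fun_pair; first exact: measurable_ffun_app.
apply: measurable_to_ffun => j.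
rewrite (_ : (fun _ => _) =
  fun x : {ffun 'I_n.+1 -> R} => x (lift ord0 j)).
  exact: measurable_ffun_app.
by apply/funext => x; rewrite ffunE.
Qed.

Fixpoint lebesgue_ord n : {sigma_finite_measure set {ffun 'I_n -> R} -> \bar R} :=
  if n is m.+1 then
    @pushforward_sf _ _ (measurableTypeR R * {ffun 'I_m -> R})%type
      {ffun 'I_m.+1 -> R} R (lebesgue_measure \x lebesgue_ord m)%E _ _
      (product_measure1_sigma_finite lebesgue_measure (lebesgue_ord m))
      (@measurable_ffun_cons m) (@measurable_ffun_uncons m) (@ffun_consK m)
  else \d_ ([ffun=> 0] : {ffun 'I_0 -> R}).


Definition ffun_of_ord (T : finType) (x : {ffun 'I_#|T| -> R}) : {ffun T -> R} :=
  [ffun t => x (enum_rank t)].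

Definition ffun_to_ord (T : finType) (x : {ffun T -> R}) : {ffun 'I_#|T| -> R} :=
  [ffun i => x (enum_val i)].

Lemma ffun_of_ordK T : cancel (@ffun_of_ord T) (@ffun_to_ord T).
Proof. by move=> x; apply/ffunP => i; rewrite !ffunE enum_valK. Qed.

Lemma measurable_ffun_of_ord T : measurable_fun setT (@ffun_of_ord T).
Proof.
apply: measurable_to_ffun => t.
rewrite (_ : (fun _ => _) = fun x : {ffun 'I_#|T| -> R} => x (enum_rank t)).
  exact: measurable_ffun_app.
by apply/funext => x; rewrite ffunE.
Qed.

Lemma measurable_ffun_to_ord T : measurable_fun setT (@ffun_to_ord T).
Proof.
apply: measurable_to_ffun => i.
rewrite (_ : (fun _ => _) = fun x : {ffun T -> R} => x (enum_val i)).
  exact: measurable_ffun_app.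
by apply/funext => x; rewrite ffunE.
Qed.

(* By [lebesgue_ffun_box] below this does not depend on the enumeration of
   [T]. *)
Definition lebesgue_ffun (T : finType) :
    {sigma_finite_measure set {ffun T -> R} -> \bar R} :=
  pushforward_sf (sigma_finiteT (lebesgue_ord #|T|))
    (@measurable_ffun_of_ord T) (@measurable_ffun_to_ord T) (@ffun_of_ordK T).

Lemma measurable_box (T : finType) (A : T -> set R) :
  (forall t, measurable (A t)) ->
  measurable [set x : {ffun T -> R} | forall t, A t (x t)].
Proof.
move=> mA.
rewrite (_ : [set x : {ffun T -> R} | _] =
  \bigcap_(t in [set: T]) ((fun x : {ffun T -> R} => x t) @^-1` A t)).
  apply: fin_bigcap_measurable => [|t _]; first exact: finite_finset.
  by rewrite -[X in measurable X]setTI; exact: measurable_ffun_app.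
by apply/seteqP; split=> [x xA t _|x xA t]; [exact: xA|exact: (xA t)].
Qed.

Lemma lebesgue_ord_box n (A : 'I_n -> set R) :
  (forall i, measurable (A i)) ->
  lebesgue_ord n [set x : {ffun 'I_n -> R} | forall i, A i (x i)] =
  (\prod_(i < n) lebesgue_measure (A i))%E.
Proof.
elim: n A => [|n IHn] A mA.
  rewrite big_ord0 /= diracE mem_set// => -[].
  by [].
rewrite big_ord_recl /= /pushforward.
rewrite (_ : _ @^-1` _ = A ord0 `*`
  [set x : {ffun 'I_n -> R} | forall i, A (lift ord0 i) (x i)]); last first.
  apply/seteqP; split=> [[a x] /= h|[a x] /= [h0 h] i].
    split=> [|i]; first by have := h ord0; rewrite ffunE unlift_none.
    by have := h (lift ord0 i); rewrite ffunE liftK.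
  by rewrite ffunE; case: unliftP => [j ->|->].
have mA' i : measurable (A (lift ord0 i)) by [].
have mB := measurable_box mA'.
rewrite product_measure1E//.
  by have /= -> := IHn _ mA'.
exact: mA.
Qed.

Lemma lebesgue_ffun_box (T : finType) (A : T -> set R) :
  (forall t, measurable (A t)) ->
  lebesgue_ffun T [set x : {ffun T -> R} | forall t, A t (x t)] =
  (\prod_t lebesgue_measure (A t))%E.
Proof.
move=> mA; rewrite /lebesgue_ffun pushforward_sfE.
rewrite (_ : _ @^-1` _ =
    [set x : {ffun 'I_#|T| -> R} | forall i, A (enum_val i) (x i)]).
  have mA' (i : 'I_#|T|) : measurable (A (enum_val i)) by [].
  have /= -> := lebesgue_ord_box mA'.
  rewrite [RHS](reindex (@enum_val T T))//.
  by apply: onW_bij; exact: enum_val_bij.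
apply/seteqP; split=> x /= h t.
  by have := h (enum_val t); rewrite ffunE enum_valK.
by have := h (enum_rank t); rewrite ffunE enum_rankK.
Qed.

End lebesgue_ffun.

Section densities.
Local Open Scope ereal_scope.
Variable R : realType.

Definition is_pdf d (X : measurableType d) (mu : set X -> \bar R) (D : set X)
    (f : X -> \bar R) : Prop :=
  [/\ measurable_fun D f, (forall x, D x -> 0 <= f x) &
      \int[mu]_(x in D) f x = 1].

Definition has_pdf d (X : measurableType d) (P mu : set X -> \bar R)
    (D : set X) (f : X -> \bar R) : Prop :=
  is_pdf mu D f /\
  forall A, measurable A -> P A = \int[mu]_(x in A `&` D) f x.

Definition quantile (F : R -> \bar R) (u : R) : R :=
  inf [set y : R | u%:E <= F y].

Variable T : finType.

Definition orthant : set {ffun T -> R} := [set x | forall t, (0 < x t)%R].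

Definition open_cube : set {ffun T -> R} :=
  [set u | forall t, (0 < u t < 1)%R].

Definition marginal (P : set {ffun T -> R} -> \bar R) (t : T) :
    set (measurableTypeR R) -> \bar R :=
  pushforward P (fun x : {ffun T -> R} => x t : measurableTypeR R).

Definition marginal_cdf (P : set {ffun T -> R} -> \bar R) (t : T) (y : R) :
    \bar R :=
  marginal P t `]-oo, y].

(* A copula is represented by the probability measure on [R^T] of which it is
   the distribution function. *)
Definition is_copula (C : probability {ffun T -> R} R) : Prop :=
  forall t u, (0 <= u <= 1)%R -> marginal_cdf C t u = u%:E.

(* Sklar's identity [F x = C (F_t (x_t))_t]. *)
Definition copula_of (P C : probability {ffun T -> R} R) : Prop :=
  is_copula C /\
  forall x : {ffun T -> R},
    P [set y | forall t, (y t <= x t)%R] =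
    C [set v | forall t, (v t)%:E <= marginal_cdf P t (x t)].

(* If [P] is absolutely continuous its margins are continuous, so its copula
   is unique. *)
Definition copula_pdf (P : probability {ffun T -> R} R)
    (c : {ffun T -> R} -> R) : Prop :=
  exists2 C, copula_of P C &
    has_pdf C (lebesgue_ffun R T) open_cube (fun u => (c u)%:E).

End densities.

Arguments orthant {R T}.
Arguments open_cube {R T}.

(* [{ffun idx J -> R}] is [R^J]. *)
Definition idx d (J : {set 'I_d}) : finType := {i : 'I_d | i \in J}.

(* Correspondence with the usual notation:
     [subvec J x]               x_J
     [margin r xJ]              r_J(x_J)
     [cond r xI xJ]             r_{I|J}(x_I | x_J)
     [cond1 r i t xJ]           r_{i|J}(t | x_J)
     [cond_cdf r i t xJ]        R_{i|J}(t | x_J)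
     [cond_quantile r i u xJ]   R_{i|J}^{-1}(u | x_J)
     [cond_copula_pdf r u xJ]   c_{I;J}(u_I; x_J)
   Functions on [(0, +oo)^T] are total on [R^T]; their values off [orthant]
   are never used. *)
Section tail_copula.
Local Open Scope ereal_scope.
Variables (R : realType) (d : nat).
Implicit Types I J : {set 'I_d}.

Definition subvec J (x : {ffun 'I_d -> R}) : {ffun idx J -> R} :=
  [ffun j => x (val j)].

(* The vector whose coordinates are [x_i] for [i \in I] and [y_j] for
   [j \in J], for disjoint [I] and [J]. The other coordinates are set to [0]
   and are dropped by [subvec] wherever they exist. *)
Definition glue_vec I J (x : {ffun idx I -> R}) (y : {ffun idx J -> R}) :
    {ffun 'I_d -> R} :=
  [ffun k => if insub k is Some i then x i
             else if insub k is Some j then y j else 0%R].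

Definition margin (r : {ffun 'I_d -> R} -> R) J (xJ : {ffun idx J -> R}) :
    \bar R :=
  \int[lebesgue_ffun R (idx (~: J))]_(y in orthant) (r (glue_vec xJ y))%:E.

Lemma glue_vecL I J (x : {ffun idx I -> R}) (y : {ffun idx J -> R}) (i : idx I) :
  glue_vec x y (val i) = x i.
Proof. by rewrite ffunE valK. Qed.

Lemma glue_vecR I J (x : {ffun idx I -> R}) (y : {ffun idx J -> R}) (j : idx J) :
  [disjoint I & J]%bool -> glue_vec x y (val j) = y j.
Proof.
move=> dIJ; rewrite ffunE valK insubF//.
by apply/negbTE; rewrite (disjointFl dIJ)// (valP j).
Qed.

(* The marginal density at [t] of the [i]-th coordinate, for a density [f] on
   [(0, +oo)^I]. *)
Definition marginal_pdf I (f : {ffun idx I -> R} -> \bar R) (i : idx I)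
    (t : R) : \bar R :=
  \int[lebesgue_ffun R (idx (I :\ val i))]_(y in orthant)
    f (subvec I (glue_vec (I := [set val i]%SET) [ffun=> t] y)).

Definition cond (r : {ffun 'I_d -> R} -> R) I J (xI : {ffun idx I -> R})
    (xJ : {ffun idx J -> R}) : \bar R :=
  margin r (subvec (I :|: J) (glue_vec xI xJ)) / margin r xJ.

Definition cond1 (r : {ffun 'I_d -> R} -> R) (i : 'I_d) J
    (t : R) (xJ : {ffun idx J -> R}) : \bar R :=
  cond r (I := [set i]%SET) [ffun=> t] xJ.

Definition cond_cdf (r : {ffun 'I_d -> R} -> R) (i : 'I_d) J
    (t : R) (xJ : {ffun idx J -> R}) : \bar R :=
  \int[lebesgue_measure]_(s in `]0%R, t]) cond1 r i s xJ.

Definition cond_quantile (r : {ffun 'I_d -> R} -> R) (i : 'I_d) J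
    (u : R) (xJ : {ffun idx J -> R}) : R :=
  quantile (fun t => cond_cdf r i t xJ) u.

(* The value is [0] if the denominator is [0] or some term is
   infinite, since [fine] sends infinities to [0] and [0^-1 = 0] in [R]. *)
Definition cond_copula_pdf (r : {ffun 'I_d -> R} -> R) I J
    (u : {ffun idx I -> R}) (xJ : {ffun idx J -> R}) : R :=
  let x : {ffun idx I -> R} :=
    [ffun i => cond_quantile r (val i) (u i) xJ] in
  (fine (cond r x xJ) / \prod_i fine (cond1 r (val i) (x i) xJ))%R.

Definition tail_copula_density (r : {ffun 'I_d -> R} -> R) : Prop :=
  [/\ measurable_fun orthant r,
      (forall x, orthant x -> (0 <= r x)%R),
      (forall (j : 'I_d) (x : {ffun idx [set j]%SET -> R}),
         orthant x -> margin r x = 1) &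
      (forall (s : R) (x : {ffun 'I_d -> R}), (0 < s)%R -> orthant x ->
         r [ffun i => s * x i]%R = (s ^ (1 - d%:Z) * r x)%R)].

End tail_copula.

(* Main.v *)
Require Import Defs.
From HB Require Import structures.
From mathcomp Require Import all_boot all_order all_algebra.
From mathcomp Require Import all_classical all_reals all_analysis.
From mathcomp Require Import measurable_realfun.

(* The first two claims are Tonelli's theorem on R^T, split along a partition of
   the index set T.

   For the copula, let F_i and Q_i be the distribution and quantile functions of
   the i-th margin, with density f_i. Then Q_i u <= y iff u <= F_i y, and
   F_i (Q_i u) = u because F_i is continuous, so u |-> (Q_i (u_i))_i maps
   Lebesgue measure on the open cube to the measure with density
   prod_i f_i (x_i). The conditional density k vanishes almost everywhere where
   some f_i (x_i) is 0 or infinite, hence k = (k / prod_i f_i) * prod_i f_i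
   almost everywhere. The change of variables x = Q u therefore turns integrals
   of the proposed copula density into P-measures, and both Sklar's identity and
   the uniformity of the margins are read off the equivalence above, exactly and
   without discarding null sets. *)

Set Implicit Arguments.
Unset Strict Implicit.
Unset Printing Implicit Defensive.
Import Order.TTheory GRing.Theory Num.Theory.
Local Open Scope classical_set_scope.
Local Open Scope ring_scope.
Local Open Scope ereal_scope.

(** * Measures with a density *)

Section density_measure.
Context d (X : measurableType d) (R : realType).
Variables (mu : {measure set X -> \bar R}) (w : X -> \bar R).
Hypotheses (mw : measurable_fun [set: X] w) (w0 : forall x, 0 <= w x).

(** The two proofs are arguments of the term, so that canonical structure inference recovers from it
    the measure instance declared below. *)
Definition density_measure of measurable_fun [set: X] w
    & (forall x, 0 <= w x) :=
  fun A : set X => \int[mu]_(x in A) w x.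

Local Notation nu := (density_measure mw w0).

Let nu0 : nu set0 = 0. Proof. exact: integral_set0. Qed.

Let nu_ge0 A : 0 <= nu A. Proof. exact: integral_ge0. Qed.

Let nu_sigma_additive : semi_sigma_additive nu.
Proof. exact: semi_sigma_additive_nng_induced. Qed.

HB.instance Definition _ := isMeasure.Build _ _ _
  nu nu0 nu_ge0 nu_sigma_additive.

Import HBNNSimple.

Let integral_density_indic (E : set X) : measurable E ->
  \int[nu]_x (\1_E x)%:E = \int[mu]_x ((\1_E x)%:E * w x).
Proof.
move=> mE; rewrite integral_indic// setIT.
transitivity (\int[mu]_(x in E) w x) => //.
rewrite integral_mkcond; apply: eq_integral => x _.
by rewrite patchE indicE; case: ifP => _; rewrite ?mul1e ?mul0e.
Qed.

Let integral_density_nnsfun (f : {nnsfun X >-> R}) :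
  \int[nu]_x (f x)%:E = \int[mu]_x ((f x)%:E * w x).
Proof.
under [LHS]eq_integral do rewrite fimfunE -fsumEFin//.
rewrite [LHS]ge0_integral_fsum//; last 2 first.
  - by move=> r; exact/measurable_EFinP/measurableT_comp.
  - by move=> n x _; rewrite EFinM nnfun_muleindic_ge0.
under [RHS]eq_integral.
  move=> x _; rewrite fimfunE -fsumEFin// muleC ge0_mule_fsumr; last first.
    by move=> r; rewrite EFinM nnfun_muleindic_ge0.
  over.
rewrite [RHS]ge0_integral_fsum//; last 2 first.
  - by move=> r; apply: emeasurable_funM => //;
      apply/measurable_EFinP; apply/measurableT_comp => //.
  - by move=> n x _; rewrite mule_ge0// EFinM nnfun_muleindic_ge0.
apply: eq_fsbigr => r _.
rewrite integralZl_indic_nnsfun// integral_density_indic//.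
have [r0|r0] := leP 0%R r.
  rewrite -ge0_integralZl//.
  - by apply: eq_integral => x _; rewrite EFinM muleA muleC.
  - by apply: emeasurable_funM => //; exact/measurable_EFinP/measurable_indic.
  - by move=> x _; rewrite mule_ge0// lee_fin.
(* The function is nonnegative, so a negative level has an empty level set and both sides are 0. *)
have -> : f @^-1` [set r] = set0 by exact: preimage_nnfun0.
rewrite !integral0_eq ?mule0// => x _;
  by rewrite indicE in_set0 ?mulr0 ?mul0e ?mule0.
Qed.

(** The standard machine: the identity passes from indicators to simple functions by linearity, then
    to [f] by monotone convergence on both sides. *)
Lemma ge0_integral_density (f : X -> \bar R) :
  measurable_fun [set: X] f -> (forall x, 0 <= f x) ->
  \int[nu]_x f x = \int[mu]_x (f x * w x).
Proof.
move=> mf f0.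
pose f_ := nnsfun_approx measurableT mf.
have f_f x : (f_ n x)%:E @[n --> \oo] --> f x by exact: cvg_nnsfun_approx.
have nd_f x m n : (m <= n)%N -> (f_ m x <= f_ n x)%R.
  by move=> mn; exact/lefP/nd_nnsfun_approx.
transitivity (lim (\int[nu]_x (f_ n x)%:E @[n --> \oo])).
  rewrite -monotone_convergence//=.
  - by apply: eq_integral => x _; apply/esym/cvg_lim.
  - by move=> n; exact/measurable_EFinP/measurable_funTS.
  - by move=> n x _; rewrite lee_fin.
  - by move=> x _ m n mn; rewrite lee_fin nd_f.
under eq_fun do rewrite integral_density_nnsfun.
rewrite -monotone_convergence//=.
- apply: eq_integral => x _; apply/cvg_lim => //.
  (* Multiplication is discontinuous at [0 * +oo]. If [f x = 0], every approximation vanishes at [x]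
     and the products are constantly 0; otherwise an infinite [w x] meets a non-zero limit. *)
  have [fx0|fx0] := eqVneq (f x) 0.
    have f_0 n : (f_ n x)%:E = 0.
      apply/eqP; rewrite eq_le; apply/andP; split; last by rewrite lee_fin.
      rewrite -fx0 -(cvg_lim _ (f_f x))//.
      rewrite (cvg_lim _ (ereal_nondecreasing_cvgn _))//; last first.
        by move=> m k mk; rewrite lee_fin nd_f.
      by apply: ereal_sup_ubound; exists n.

    by under eq_fun do rewrite f_0 mul0e; rewrite fx0 mul0e; exact: cvg_cst.
  case wxE : (w x) => [s| |].
  - by apply: cvgeMr.
  - apply: cvgeM => //; last exact: cvg_cst.
    by apply: mule_def_neq0_infty.  - by have := w0 x; rewrite wxE.
- move=> n; apply: emeasurable_funM => //.
  exact/measurable_EFinP/measurable_funTS.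
- by move=> n x _; rewrite mule_ge0// lee_fin.
- by move=> x _ m n mn; rewrite lee_wpmul2r// lee_fin nd_f.
Qed.

Lemma exists_density_probability : \int[mu]_x w x = 1 ->
  exists P : probability X R, forall A, P A = \int[mu]_(x in A) w x.
Proof.
move=> w1.
have nuT : density_measure mw w0 setT = 1 by exact: w1.
pose P : probability X R := HB.pack (density_measure mw w0)
  (Measure_isProbability.Build _ _ _ (density_measure mw w0) nuT).
by exists P.
Qed.

End density_measure.

(** * Lebesgue measure on finite powers of the line *)

Section ffun_measure.
Variable R : realType.

Definition box (T : finType) (A : T -> set R) : set {ffun T -> R} :=
  [set x | forall t, A t (x t)].

(** Boxes with measurable sides are stable under intersection and generate the product
    sigma-algebra, and the cubes with sides [-n, n] exhaust the space, so the uniqueness theorem for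
    measures applies. *)
Lemma ffun_measure_unique (T : finType)
    (m1 m2 : {measure set {ffun T -> R} -> \bar R}) :
  (forall n : nat, m1 (box (fun=> `[(- n%:R)%R, n%:R]%classic)) < +oo) ->
  (forall A : T -> set R, (forall t, measurable (A t)) ->
    m1 (box A) = m2 (box A)) ->
  forall B, measurable B -> m1 B = m2 B.
Proof.
move=> m1oo m12 B mB.
pose G := [set B : set {ffun T -> R} | exists2 A : T -> set R,
  (forall t, measurable (A t)) & B = box A].
apply: (measure_unique G
  (fun n => box (fun=> `[(- n%:R)%R, n%:R]%classic))) => //.
- apply/seteqP; split=> [C|].
    apply: smallest_sub; first exact: smallest_sigma_algebra.
    move=> _ [t _ [Y mY <-]]; apply: sub_sigma_algebra.
    exists (fun s => if s == t then Y else setT) => [s|].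
      by case: ifP.
    apply/seteqP; split=> [x [_ xY] s|x xY]; first by case: eqP => [->|].
    by split=> //; have := xY t; rewrite eqxx.
  apply: smallest_sub; first exact: sigma_algebra_measurable.
  by move=> _ [A mA ->]; exact: measurable_box.
- move=> _ _ [A mA ->] [A' mA' ->]; exists (fun t => A t `&` A' t).
    by move=> t; exact: measurableI.
  by apply/seteqP; split=> [x [xA xA'] t|x xA]; split=> // t; have [] := xA t.
- by move=> n; exists (fun=> `[(- n%:R)%R, n%:R]%classic).
- apply/seteqP; split=> // x _.
  exists (\max_t Num.truncn `|x t|).+1 => // t /=.
  rewrite in_itv/= -ler_norml.
  apply: (le_trans (ltW (truncnS_gt _))); rewrite ler_nat ltnS.
  exact: leq_bigmax.
- by move=> _ [A mA ->]; exact: m12.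
Qed.

(** This identifies other constructions, such as images of product measures, with [lebesgue_ffun]
    without opening the enumeration of [T] used in its definition. *)
Lemma lebesgue_ffun_unique (T : finType)
    (m : {measure set {ffun T -> R} -> \bar R}) :
  (forall A : T -> set R, (forall t, measurable (A t)) ->
    m (box A) = \prod_t lebesgue_measure (A t)) ->
  forall B, measurable B -> lebesgue_ffun R T B = m B.
Proof.
move=> mbox; apply: ffun_measure_unique => [n|A mA].
  rewrite [ltLHS]lebesgue_ffun_box//.
  rewrite -ge0_fin_numE ?prode_ge0//; apply: prode_fin_num => t _.
  by rewrite lebesgue_measure_itv/=; case: ifP.
by rewrite mbox//; exact: lebesgue_ffun_box.
Qed.

(* Tonelli's theorem, [T] being partitioned into the images of [a] and [b]. *)
Lemma ge0_integral_lebesgue_ffun (T T1 T2 : finType) (a : T1 -> T) (b : T2 -> T)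
    (g : {ffun T1 -> R} * {ffun T2 -> R} -> {ffun T -> R})
    (f : {ffun T -> R} -> \bar R) :
  injective a -> injective b -> (forall i j, a i != b j) ->
  (forall t, (exists i, t = a i) \/ (exists j, t = b j)) ->
  (forall x y i, g (x, y) (a i) = x i) ->
  (forall x y j, g (x, y) (b j) = y j) ->
  measurable_fun setT f -> (forall z, 0 <= f z) ->
  \int[lebesgue_ffun R T]_z f z =
  \int[lebesgue_ffun R T1]_x \int[lebesgue_ffun R T2]_y f (g (x, y)).
Proof.
move=> inja injb ab abT ga gb mf f0.
have mg : measurable_fun setT g.
  apply: measurable_to_ffun => t; have [[i ->]|[j ->]] := abT t.
    rewrite (_ : (fun _ => _) = (fun x : {ffun T1 -> R} => x i) \o fst).
      by apply: measurableT_comp => //; exact: measurable_ffun_app.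
    by apply/funext => -[x y] /=; rewrite ga.
  rewrite (_ : (fun _ => _) = (fun x : {ffun T2 -> R} => x j) \o snd).
    by apply: measurableT_comp => //; exact: measurable_ffun_app.
  by apply/funext => -[x y] /=; rewrite gb.
pose m := (lebesgue_ffun R T1 \x lebesgue_ffun R T2).
(* Lebesgue measure is the image under [g] of the product measure, because the preimage of a box is
   a product of two boxes. *)
have mE B : measurable B -> lebesgue_ffun R T B = pushforward m g B.
  apply: lebesgue_ffun_unique => A mA.
  suff : m (g @^-1` box A) = \prod_t lebesgue_measure (A t) by [].
  rewrite (_ : _ @^-1` _ = box (A \o a) `*` box (A \o b)); last first.
    apply/seteqP; split=> [[x y] /= xyA|[x y] [/= xA yA] t].
      split=> [i|j]; [have := xyA (a i)|have := xyA (b j)]; rewrite ?ga ?gb //.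
    by have [[i ->]|[j ->]] := abT t; rewrite ?ga ?gb; [exact: xA|exact: yA].
  rewrite /m product_measure1E; [|by apply: measurable_box => t; exact: mA..].
  rewrite [X in X * _]lebesgue_ffun_box; last by move=> t; exact: mA.
  rewrite [X in _ * X]lebesgue_ffun_box; last by move=> t; exact: mA.
  (* This splits the product of the side lengths over [T] into the products over [T1] and [T2]. *)
  have perm_enum : perm_eq (index_enum T)
      (map a (index_enum T1) ++ map b (index_enum T2)).
    apply: uniq_perm; first exact: index_enum_uniq.
      rewrite cat_uniq !map_inj_uniq// !index_enum_uniq andbT/=.
      by apply/hasPn => _ /mapP[j _ ->]; apply/mapP => -[i _ /esym/eqP];
        exact/negP.
    move=> t; rewrite mem_index_enum mem_cat; apply/esym/orP.
    have [[i ->]|[j ->]] := abT t; [left|right]; apply: map_f;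
      by rewrite mem_index_enum.
  by rewrite (perm_big _ perm_enum)/= big_cat/= !big_map.
transitivity (\int[pushforward m g]_z f z).
  by apply: eq_measure_integral => B mB _; exact: mE.
rewrite ge0_integral_pushforward// preimage_setT.
rewrite fubini_tonelli1//; first exact: measurableT_comp.
by move=> z; exact: f0.
Qed.

Lemma ge0_integral_lebesgue_ffun1 (T : finType) (f : {ffun T -> R} -> \bar R) :
  #|T| = 1%N -> measurable_fun setT f -> (forall z, 0 <= f z) ->
  \int[lebesgue_ffun R T]_z f z = \int[lebesgue_measure]_t f [ffun=> t].
Proof.
move=> T1 mf f0.
have [t0 allt0] : exists t0, forall t : T, t = t0.
  by have /fintype1[t0 h] := T1; exists t0.
pose g (s : measurableTypeR R) : {ffun T -> R} := [ffun=> s].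
have mg : measurable_fun setT g.
  apply: measurable_to_ffun => t.
  rewrite (_ : (fun _ => _) = id); first exact: measurable_id.
  by apply/funext => s; rewrite ffunE.
transitivity (\int[pushforward lebesgue_measure g]_z f z).
  apply: eq_measure_integral => B mB _; apply: lebesgue_ffun_unique => // A mA.
  rewrite (bigD1 t0)//= big1 ?mule1; last first.
    by move=> t; rewrite (allt0 t) eqxx.
  suff : lebesgue_measure (g @^-1` box A) = lebesgue_measure (A t0) by [].
  congr lebesgue_measure; apply/seteqP; split=> s.
    by move=> /(_ t0); rewrite ffunE.
  by move=> sA t; rewrite (allt0 t) ffunE.
by rewrite ge0_integral_pushforward// preimage_setT.
Qed.

(** Induction on the cardinality of [T]: Tonelli splits off one coordinate [t0], indexed by [unit],
    from the others, indexed by the complement of [t0]. *)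
Lemma ge0_integral_prod_lebesgue_ffun (T : finType) (h : T -> R -> R) :
  (forall t, measurable_fun setT (h t)) -> (forall t s, (0 <= h t s)%R) ->
  \int[lebesgue_ffun R T]_x (\prod_t h t (x t))%:E =
  \prod_t \int[lebesgue_measure]_s (h t s)%:E.
Proof.
move En : #|T| => n; elim: n T En h => [|n IHn] T En h mh h0.
  have T0 (t : T) : False by have := fintype0 t; rewrite En.
  rewrite big1; last by move=> t; case: (T0 t).
  under eq_integral => x _.
    rewrite big1; last by move=> t; case: (T0 t).
    over.
  rewrite integral_cst// mul1e.
  (* For empty [T] the whole space is a box whose measure is an empty product, that is 1. *)
  transitivity (lebesgue_ffun R T (box (fun=> setT))).
    by congr (lebesgue_ffun R T _); apply/seteqP; split.
  rewrite [LHS]lebesgue_ffun_box// big1// => t; by case: (T0 t).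
have /card_gt0P[t0 _] : (0 < #|T|)%N by rewrite En.
pose T2 : finType := {t : T | t \in predC1 t0}.
pose g (p : {ffun unit -> R} * {ffun T2 -> R}) : {ffun T -> R} :=
  [ffun t => if insub t is Some s then p.2 s else p.1 tt].
have g0 x y : g (x, y) t0 = x tt by rewrite ffunE insubF// inE eqxx.
have gv x y (j : T2) : g (x, y) (val j) = y j by rewrite ffunE valK.
rewrite (@ge0_integral_lebesgue_ffun T unit T2 (fun=> t0) val g); last 8 first.
- by case=> -[].
- exact: val_inj.
- by move=> _ j; rewrite eq_sym; exact: (valP j).
- move=> t; have [->|tt0] := eqVneq t t0; first by left; exists tt.
  by right; exists (Sub t tt0).
- by move=> x y [].
- exact: gv.
- apply/measurable_EFinP; apply: measurable_prod => t _.
  exact: (measurableT_comp (mh t) (measurable_ffun_app t)).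
- by move=> z; rewrite lee_fin prodr_ge0.
have prodg x y : (\prod_t h t (g (x, y) t) =
    h t0 (x tt) * \prod_(j : T2) h (val j) (y j))%R.
  rewrite (bigD1 t0)//= g0; congr (_ * _)%R.
  rewrite (big_sub (predC1 t0) (fun t => h t (g (x, y) t))).
  by apply: eq_bigr => j _; rewrite gv.
have En2 : #|T2| = n by rewrite card_sig (eq_card (B := predC1 t0))// cardC1 En.
pose c := \prod_(j : T2) \int[lebesgue_measure]_s (h (val j) s)%:E.
transitivity (\int[lebesgue_ffun R unit]_x ((h t0 (x tt))%:E * c)).
  apply: eq_integral => x _.
  under eq_integral do rewrite prodg EFinM.
  rewrite ge0_integralZl//; first by rewrite (IHn T2 En2 (fun j => h (val j))).
  - apply/measurable_EFinP; apply: measurable_prod => t _.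
    exact: (measurableT_comp (mh _) (measurable_ffun_app t)).
  - by move=> y _; rewrite lee_fin prodr_ge0.
  - by rewrite lee_fin.
have mh0 : measurable_fun setT (fun x : {ffun unit -> R} => (h t0 (x tt))%:E).
  apply/measurable_EFinP.
  exact: (measurableT_comp (mh _) (measurable_ffun_app tt)).
rewrite ge0_integralZr//; last 2 first.
- by move=> x _; rewrite lee_fin.
- by apply: prode_ge0 => j _; apply: integral_ge0 => s _; rewrite lee_fin.
rewrite ge0_integral_lebesgue_ffun1 ?card_unit//; last first.
  by move=> x; rewrite lee_fin.
under eq_integral do rewrite ffunE.
rewrite [RHS](bigD1 t0)//=; congr (_ * _).
by rewrite (big_sub (predC1 t0) (fun t => \int[lebesgue_measure]_s (h t s)%:E)).
Qed.

End ffun_measure.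

(** * The quantile transform *)

Section quantile_transform.
Variables (R : realType) (f : measurableTypeR R -> \bar R).
Hypotheses (mf : measurable_fun [set: measurableTypeR R] f)
  (f0 : forall s, 0 <= f s) (f1 : \int[lebesgue_measure]_s f s = 1).

Let nu : {measure set (measurableTypeR R) -> \bar R} :=
  density_measure lebesgue_measure mf f0.

Let F (y : R) := \int[lebesgue_measure]_(s in `]-oo, y]) f s.

Local Notation Q := (quantile F).

Let nuT : nu setT = 1. Proof. exact: f1. Qed.

Let nu_le1 A : measurable A -> nu A <= 1.
Proof. by move=> mA; rewrite -nuT; apply: le_measure; rewrite ?inE. Qed.

Let FE y : F y = nu `]-oo, y]%classic. Proof. by []. Qed.

Let F_le x y : (x <= y)%R -> F x <= F y.
Proof.
move=> xy; rewrite !FE; apply: le_measure; rewrite ?inE//.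
by move=> z /=; rewrite !in_itv/= => /le_trans; exact.
Qed.

Lemma density_cdf_fin_num y : F y \is a fin_num.
Proof.
by rewrite FE ge0_fin_numE// (le_lt_trans (nu_le1 _))// ltry.
Qed.

Section level.
Variable u : R.
Hypothesis u01 : (0 < u < 1)%R.

Let S := [set y : R | u%:E <= F y].

(** F(n) tends to 1 > u. Together with [S_lb] this makes [inf S] a genuine infimum and not the
    default value of [inf]. *)
Let S_nonempty : S !=set0.
Proof.
have ndI : nondecreasing_seq (fun n : nat => `]-oo, n%:R]%classic : set R).
  move=> m n mn; apply/subsetPset => x /=.
  rewrite !in_itv/= => /le_trans; apply.
  by rewrite ler_nat.
have IT : \bigcup_n (`]-oo, n%:R]%classic : set R) = setT.
  apply/seteqP; split=> // x _; exists (Num.truncn `|x|).+1 => //=.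
  by rewrite in_itv/= (le_trans (ler_norm _))// ltW// truncnS_gt.
have := @nondecreasing_cvg_mu _ _ _ nu
    (fun n : nat => `]-oo, n%:R]%classic).
rewrite IT nuT => /(_ _ measurableT ndI) cvg1.
have {}cvg1 := cvg1 (fun=> measurable_itv _).
apply: contrapT => S0.
have : 1 <= u%:E.
  rewrite -(cvg_lim _ cvg1)//; apply: lime_le; first by apply/cvg_ex; exists 1.
  apply: nearW => n /=; rewrite leNgt; apply/negP => /ltW uF; apply: S0.
  by exists n%:R.
by rewrite lee_fin leNgt; case/andP: u01 => _ ->.
Qed.

(** F(-n) tends to 0 < u, and by monotonicity any -n with F(-n) < u bounds [S] from below. *)
Let S_lb : has_lbound S.
Proof.
have niI : nonincreasing_seq
    (fun n : nat => `]-oo, (- n%:R)%R]%classic : set R).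
  move=> m n mn; apply/subsetPset => x /=.
  rewrite !in_itv/= => /le_trans; apply.
  by rewrite lerN2 ler_nat.
have I0 : \bigcap_n (`]-oo, (- n%:R)%R]%classic : set R) = set0.
  apply/seteqP; split=> // x /(_ (Num.truncn `|x|).+1 I) /=.
  rewrite in_itv/= lerNr => h.
  have := le_trans h (ler_norm _).
  by rewrite normrN leNgt truncnS_gt.
have := @nonincreasing_cvg_mu _ _ _ nu
    (fun n : nat => `]-oo, (- n%:R)%R]%classic).
rewrite I0 measure0 => /(_ _ _ measurable0 niI) cvg0.
have {}cvg0 := cvg0 (le_lt_trans (nu_le1 (measurable_itv _)) (ltry _))
  (fun=> measurable_itv _).
apply: contrapT => Slb.
have : u%:E <= 0.
  rewrite -(cvg_lim _ cvg0)//; apply: lime_ge; first by apply/cvg_ex; exists 0.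
  apply: nearW => n /=; rewrite leNgt; apply/negP => Fu; apply: Slb.
  exists (- n%:R)%R => y /= uy; rewrite leNgt; apply/negP => /ltW/F_le yn.
  by have := le_lt_trans (le_trans uy yn) Fu; rewrite ltxx.
by rewrite lee_fin leNgt; case/andP: u01 => ->.
Qed.

(** Points below [Q u] are not in [S], so F < u there; since a measure with a density has no atoms,
    F is left continuous and F (Q u) <= u. Conversely [S] has points arbitrarily close to its
    infimum, and right continuity gives u <= F (Q u). *)
Lemma density_cdf_quantile : F (Q u) = u%:E.
Proof.
apply/eqP; rewrite eq_le; apply/andP; split.
  have ndI : nondecreasing_seq
      (fun n : nat => `]-oo, (Q u - n.+1%:R^-1)%R]%classic : set R).
    move=> m n mn; apply/subsetPset => x /=.
    rewrite !in_itv/= => /le_trans; apply.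
    by rewrite lerB// lef_pV2 ?posrE// ler_nat.
  have IU : \bigcup_n (`]-oo, (Q u - n.+1%:R^-1)%R]%classic : set R) =
      `]-oo, Q u[%classic.
    apply/seteqP; split=> x.
      move=> [n _] /=; rewrite !in_itv/= => /le_lt_trans; apply.
      by rewrite ltrBlDr ltrDl.
    rewrite /= in_itv/= => xQ; have : (0 < Q u - x)%R by rewrite subr_gt0.
    move=> /ltr_add_invr[n]; rewrite add0r => /ltW hn; exists n => //=.
    by rewrite in_itv/= lerBrDl -lerBrDr.
  have -> : F (Q u) = nu `]-oo, Q u[%classic.
    by apply/esym/integral_itv_bndo_bndc; exact: measurable_funTS.
  have := @nondecreasing_cvg_mu _ _ _ nu
    (fun n : nat => `]-oo, (Q u - n.+1%:R^-1)%R]%classic).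
  rewrite IU => /(_ (fun=> measurable_itv _) (measurable_itv _) ndI) cvgQ.
  rewrite -(cvg_lim _ cvgQ)//; apply: lime_le; first by apply/cvg_ex; eexists;
    exact: cvgQ.
  apply: nearW => n /=; rewrite leNgt; apply/negP => /ltW uF.
  have : (Q u <= Q u - n.+1%:R^-1)%R by apply: ge_inf.
  by rewrite lerBrDr gerDl leNgt invr_gt0 ltr0n.
have niI : nonincreasing_seq
    (fun n : nat => `]-oo, (Q u + n.+1%:R^-1)%R]%classic : set R).
  move=> m n mn; apply/subsetPset => x /=.
  rewrite !in_itv/= => /le_trans; apply.
  by rewrite lerD2l lef_pV2 ?posrE// ler_nat.
have II : \bigcap_n (`]-oo, (Q u + n.+1%:R^-1)%R]%classic : set R) =
    `]-oo, Q u]%classic.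
  apply/seteqP; split=> x; last first.
    move=> /= xQ n _ /=; move: xQ; rewrite !in_itv/= => /le_trans; apply.
    by rewrite lerDl.
  move=> xn /=; rewrite in_itv/= leNgt; apply/negP; rewrite -subr_gt0.
  move=> /ltr_add_invr[n]; rewrite add0r => hn.
  have := xn n I; rewrite /= in_itv/= -lerBlDl => /le_lt_trans/(_ hn).
  by rewrite ltxx.
have := @nonincreasing_cvg_mu _ _ _ nu
    (fun n : nat => `]-oo, (Q u + n.+1%:R^-1)%R]%classic).
rewrite II => /(_ (le_lt_trans (nu_le1 (measurable_itv _)) (ltry _))
  (fun=> measurable_itv _) (measurable_itv _) niI) cvgQ.
rewrite FE -(cvg_lim _ cvgQ)//; apply: lime_ge; first by apply/cvg_ex; eexists;
    exact: cvgQ.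
apply: nearW => n /=.
have [y Sy yQ] : exists2 y, S y & (y < Q u + n.+1%:R^-1)%R.
  by apply: inf_adherent => //; rewrite invr_gt0.
by rewrite (le_trans Sy)// F_le// ltW.
Qed.

(** From left to right, apply the monotone F and use F (Q u) = u; from right to left, [Q u] is a
    lower bound of [S]. All later comparisons of quantiles rest on this equivalence. *)
Lemma quantile_le y : (Q u <= y)%R = (u%:E <= F y).
Proof.
apply/idP/idP => [Qy|uy]; first by rewrite -density_cdf_quantile F_le.
exact: ge_inf.
Qed.

Lemma lt_quantile y : (y < Q u)%R = (fine (F y) < u)%R.
Proof.
by rewrite ltNge quantile_le -ltNge -lte_fin fineK// density_cdf_fin_num.
Qed.

End level.

(** By [lt_quantile], the preimage of a half-line in (0, 1) is a half-line cut with (0, 1). *)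
Lemma measurable_quantile : measurable_fun (`]0%R, 1%R[%classic : set R) Q.
Proof.
move=> m01; apply: (measurability _ (RGenOInfty.measurableE R)) => //.
move=> _ [_ [y ->] <-].
rewrite (_ : _ `&` _ = `]0%R, 1%R[ `&` `]fine (F y), +oo[)%classic.
  exact: measurableI.
by apply/seteqP; split=> u [/=]; rewrite !in_itv/= ?andbT => u01;
  rewrite lt_quantile.
Qed.

(** Made total because a pushforward needs a map that is measurable on the whole line. *)
Let Q' : R -> measurableTypeR R :=
  (Q : R -> measurableTypeR R) \_ (`]0%R, 1%R[%classic : set R).

Let mQ' : measurable_fun setT Q'.
Proof.
by apply/(measurable_restrictT _ _).1 => //; exact: measurable_quantile.
Qed.

(** Inverse transform sampling. Both sides are finite measures of [A], and half-lines ]y, +oo[ form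
    a generating family stable under intersection. There both equal 1 - F y, since Q u > y means
    that u lies in ]F y, 1[. *)
Lemma quantile_law (A : set R) : measurable A ->
  lebesgue_measure (`]0%R, 1%R[ `&` Q @^-1` A)%classic =
  \int[lebesgue_measure]_(s in A) f s.
Proof.
move=> mA.
pose nu' : {measure set (measurableTypeR R) -> \bar R} :=
  measure_function_pushforward__canonical__measure_function_Measure
    (mrestr lebesgue_measure (measurable_itv `]0%R, 1%R[)) mQ'.
transitivity (nu' A).
  rewrite /nu'/= /pushforward /mrestr; congr lebesgue_measure.
  have Q'E u : (`]0%R, 1%R[%classic : set R) u -> Q' u = Q u.
    by move=> u01; rewrite /Q' patchE mem_set.
  apply/seteqP; split=> u [h1 h2]; split=> //=; first by rewrite Q'E.
  by rewrite -Q'E.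
suff : nu' A = nu A by [].
pose G := [set A : set R | exists x, A = `]x, +oo[%classic].
refine (@measure_unique _ R (measurableTypeR R) G
  (fun n => `](- n%:R)%R, +oo[%classic) _ _ _ _ nu' nu _ _ A mA) => //.
- exact: RGenOInfty.measurableE.
- move=> _ _ [x ->] [y ->]; exists (Num.max x y).
  by apply/seteqP; split=> z; rewrite /= !in_itv/= !andbT ?gt_max => /andP.
- by move=> n; exists (- n%:R)%R.
- apply/seteqP; split=> // x _; exists (Num.truncn `|x|).+1 => //=.
  rewrite in_itv/= andbT ltrNl (le_lt_trans (ler_norm _))// normrN.
  exact: truncnS_gt.
- move=> _ [y ->].
  have itvC : `]y, +oo[%classic = ~` `]-oo, y]%classic :> set R.
    by rewrite setCitvl.
  have F01 : (0 <= fine (F y) <= 1)%R.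
    rewrite fine_ge0 ?FE//= -lee_fin fineK ?nu_le1//.
    exact: density_cdf_fin_num.
  rewrite [RHS](_ : _ = 1 - F y); last first.
    rewrite FE itvC -setTD measureD//; last by rewrite [ltLHS]nuT ltry.
    by rewrite setTI [X in X - _]nuT.
  rewrite /nu'/= /pushforward /mrestr.
  rewrite (_ : _ `&` _ = `]fine (F y), 1%R[%classic); last first.
    apply/seteqP; split=> u /=.
      move=> [uy u01]; move: uy u01.
      rewrite /Q' patchE !in_itv/= andbT => uy u01.
      by move: uy; rewrite mem_set//= lt_quantile// => ->; case/andP: u01.
    rewrite !in_itv/= => /andP[Fu u1]; have u01 : (0 < u < 1)%R.
      by rewrite u1 andbT; case/andP: F01 => /le_lt_trans ->.
    by split; rewrite /= ?in_itv//= /Q' patchE mem_set ?andbT/= ?in_itv//=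
      lt_quantile.
  rewrite lebesgue_measure_itv/= lte_fin; case: ltP => F1.
    by rewrite EFinN fineK// density_cdf_fin_num.
  (* In the remaining case F y = 1: the interval ]F y, 1[ is empty and 1 - F y is 0 as well. *)
  have {}F1 : fine (F y) = 1%R.
    by apply/eqP; rewrite eq_le F1; case/andP: F01 => _ ->.
  by rewrite -(fineK (density_cdf_fin_num y)) F1 subee.
- move=> n; apply: (@le_lt_trans _ _
    (lebesgue_measure (`]0%R, 1%R[%classic : set R))).
    apply: le_measure; rewrite ?inE//; apply: measurableI => //.
    by rewrite -[X in measurable X]setTI; exact: mQ'.
  by rewrite lebesgue_measure_itv/= lte_fin ltr01 ltry.
Qed.

End quantile_transform.

(** * The copula of a distribution with a density *)

(** Inversion is continuous on the open complement of 0, and any function is measurable on a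
    singleton; so the convention at 0 does no harm. *)
Lemma measurable_invr (R : realType) : measurable_fun [set: R] (@GRing.inv R).
Proof.
rewrite -(setUv [set 0%R : R]); apply/measurable_funU => //.
  exact: measurableC.
split; first exact: measurable_fun_set1.
apply: open_continuous_measurable_fun; first exact/closed_openC/closed_eq.
by move=> x; rewrite inE => /eqP x0; exact: inv_continuous.
Qed.

Section copula_density.
Variables (R : realType) (T : finType) (P : probability {ffun T -> R} R).
Variables (k : {ffun T -> R} -> \bar R) (f : T -> measurableTypeR R -> \bar R).
Hypotheses (mk : measurable_fun setT k) (k0 : forall x, 0 <= k x)
  (Pk : forall A, measurable A -> P A = \int[lebesgue_ffun R T]_(x in A) k x).
Hypotheses (mf : forall t, measurable_fun setT (f t))
  (f0 : forall t s, 0 <= f t s)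
  (Pf : forall t A, measurable A ->
    marginal P t A = \int[lebesgue_measure]_(s in A) f t s).

Local Notation leb := (lebesgue_ffun R T).
Local Notation Q := (fun t => quantile (marginal_cdf P t)).

Let w (x : {ffun T -> R}) : R := (\prod_t fine (f t (x t)))%R.
(** The ratio of the joint density to the product of its margins. Through [fine] and [0^-1 = 0] it
    is 0 where [k] is infinite or [w] is 0. *)
Let g (x : {ffun T -> R}) : R := (fine (k x) / w x)%R.

Let mw : measurable_fun setT w.
Proof.
apply: measurable_prod => t _; apply: measurableT_comp => //.
exact: (measurableT_comp (mf t) (measurable_ffun_app t)).
Qed.

Let mg : measurable_fun setT g.
Proof.
apply: measurable_funM; first exact: measurableT_comp.
exact: (measurableT_comp (@measurable_invr R) mw).
Qed.

Let w0 x : (0 <= w x)%R.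
Proof. by apply: prodr_ge0 => t _; rewrite fine_ge0. Qed.

Let g0 x : (0 <= g x)%R.
Proof. by rewrite mulr_ge0 ?invr_ge0 ?fine_ge0. Qed.

Let f1 t : \int[lebesgue_measure]_s f t s = 1.
Proof.
rewrite -Pf// /marginal /pushforward preimage_setT; exact: probability_setT.
Qed.

Let cdfE t : marginal_cdf P t =
  fun y => \int[lebesgue_measure]_(s in `]-oo, y]) f t s.
Proof. by apply/funext => y; rewrite /marginal_cdf Pf. Qed.

Let f_integrable t : lebesgue_measure.-integrable setT (f t).
Proof.
apply/integrableP; split; first exact: mf.
by under eq_integral do rewrite gee0_abs//; rewrite f1 ltry.
Qed.

Let k_integrable : leb.-integrable setT k.
Proof.
apply/integrableP; split; first exact: mk.
under eq_integral do rewrite gee0_abs//.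
by rewrite -Pk// (@probability_setT _ _ _ P) ltry.
Qed.

(** As [fine] sends infinities to 0, this set collects the points where the margin is infinite as
    well as those where it is 0. *)
Let B t := [set s : measurableTypeR R | fine (f t s) = 0%R].

Let mB t : measurable (B t).
Proof.
have mff : measurable_fun setT (fine \o f t) by exact: measurableT_comp.
have := mff measurableT _ (measurable_set1 0%R).
by rewrite setTI.
Qed.

Let int_fine t A : measurable A ->
  \int[lebesgue_measure]_(s in A) (fine (f t s))%:E =
  \int[lebesgue_measure]_(s in A) f t s.
Proof.
move=> mA; apply: ge0_ae_eq_integral => //.
- by apply/measurable_EFinP/measurableT_comp => //; exact: measurable_funTS.
- exact: measurable_funTS.
- by move=> s _; rewrite lee_fin fine_ge0.
- have := integrable_ae measurableT (f_integrable t).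
  by apply: filterS => s /(_ Logic.I) fs _; rewrite fineK.
Qed.

(** The integral of the nonnegative [k] over this set is the mass that the [t]-th margin gives to
    [B t]. It is the integral of [fine (f t s)] over [B t], where that integrand is 0. *)
Let k_vanish t : ae_eq leb [set x | B t (x t)] k (cst 0).
Proof.
have mBt : measurable [set x : {ffun T -> R} | B t (x t)].
  have := measurable_ffun_app t measurableT (mB t : measurable (B t : set R)).
  by rewrite setTI.
apply/ae_eq_integral_abs => //; first exact: measurable_funTS.
under eq_integral do rewrite gee0_abs//.
rewrite -Pk//; transitivity (marginal P t (B t)) => //.
by rewrite Pf// -int_fine// integral0_eq// => s ->.
Qed.

(** Where [w] is non-zero and [k] finite, the division cancels. Where [w] is 0, some factor is 0, so
    the point has a coordinate in some [B t] and [k_vanish] applies. *)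
Let kE : ae_eq leb setT k (fun x => (g x * w x)%:E).
Proof.
have kB : \forall x \ae leb, 
  forall t, B t ((x : {ffun T -> R}) t) -> k x = 0.
  by apply: filter_forall => t; exact: k_vanish.
have kfin := integrable_ae measurableT k_integrable.
move: kB kfin; apply: filterS2 => x kB /(_ Logic.I) kfin _.
have [wx0|wx0] := eqVneq (w x) 0%R; last by rewrite /g divfK// fineK.
rewrite wx0 mulr0; move/eqP : wx0 => /prodf_eq0[t _ /eqP].
exact: kB.
Qed.

Let PE A : measurable A -> P A = \int[leb]_(x in A) (g x * w x)%:E.
Proof.
move=> mA; rewrite Pk//; apply: ge0_ae_eq_integral => //.
- exact: measurable_funTS.
- by apply/measurable_EFinP/measurable_funTS; exact: measurable_funM.
- by move=> x _; rewrite lee_fin mulr_ge0.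
- by have := kE; apply: filterS => x /(_ Logic.I) + _.
Qed.

Let Q' t : R -> measurableTypeR R :=
  (Q t : R -> measurableTypeR R) \_ (`]0%R, 1%R[%classic : set R).

Let Q'E t s : (0 < s < 1)%R -> Q' t s = Q t s.
Proof. by move=> s01; rewrite /Q' patchE mem_set//= in_itv. Qed.

Let mQ' t : measurable_fun setT (Q' t).
Proof.
apply/(measurable_restrictT _ _).1 => //.
by rewrite cdfE; exact: measurable_quantile.
Qed.

Let Qv (u : {ffun T -> R}) : {ffun T -> R} := [ffun t => Q' t (u t)].

Let mQv : measurable_fun setT Qv.
Proof.
apply: measurable_to_ffun => t.
rewrite (_ : (fun _ => _) = Q' t \o (fun u : {ffun T -> R} => u t)).
  exact: (measurableT_comp (mQ' t) (measurable_ffun_app t)).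
by apply/funext => u; rewrite /Qv ffunE.
Qed.

Let cube : set {ffun T -> R} := open_cube.

Let mcube : measurable cube.
Proof.
apply: (@measurable_box _ T (fun=> [set s | (0 < s < 1)%R])) => t.
rewrite (_ : [set _ | _] = `]0%R, 1%R[%classic)//.
Qed.

(** Lebesgue measure on the cube is written as a density measure with an indicator weight, so that
    [ge0_integral_density] handles both sides of the change of variables. *)
Let cube_weight (u : {ffun T -> R}) : \bar R := (\1_cube u)%:E.

Let mcube_weight : measurable_fun setT cube_weight.
Proof. exact/measurable_EFinP/measurable_indic. Qed.

Let cube_weight0 u : 0 <= cube_weight u.
Proof. by rewrite lee_fin. Qed.

Let mwE : measurable_fun setT (EFin \o w).
Proof. exact/measurable_EFinP. Qed.

Let w0E x : 0 <= (EFin \o w) x.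
Proof. by rewrite lee_fin. Qed.

(** Compared on boxes. The preimage of a box under [Qv] within the cube is a box, whose sides are
    measured by [quantile_law]; the integral of [w] over a box factorises by Tonelli. Both give the
    product of the marginal masses. *)
Let quantile_transform_law A : measurable A ->
  pushforward (density_measure leb mcube_weight cube_weight0) Qv A =
  density_measure leb mwE w0E A.
Proof.
pose m1 : {measure set {ffun T -> R} -> \bar R} :=
  measure_function_pushforward__canonical__measure_function_Measure
    (density_measure leb mcube_weight cube_weight0) mQv.
have m1box A' : (forall t, measurable (A' t)) ->
    m1 (box A') = \prod_t \int[lebesgue_measure]_(s in A' t) f t s.
  move=> mA'.
  have mQA t : measurable (`]0%R, 1%R[ `&` Q t @^-1` A' t)%classic.
    rewrite cdfE; apply: measurable_quantile => //; exact: mA'.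
  transitivity (leb (box (fun t => `]0%R, 1%R[ `&` Q t @^-1` A' t)%classic)).
    rewrite /m1/= /pushforward /density_measure /cube_weight.
    rewrite integral_indic//; last first.
      rewrite -[X in measurable X]setTI; apply: mQv => //.
      exact: measurable_box.
    congr (lebesgue_ffun R T _); apply/seteqP; split=> u.
      move=> [u01 uA] t; have ut := u01 t; have : A' t (Qv u t) by exact: uA.
      by rewrite ffunE Q'E// => ?; split=> //; rewrite /= in_itv.
    move=> uA; have u01 : cube u.
      by move=> t; have [] := uA t; rewrite /= in_itv.
    split=> // t; have [_ /=] := uA t.
    suff -> : Qv u t = Q t (u t) by [].
    by rewrite ffunE Q'E//; exact: u01.
  rewrite lebesgue_ffun_box//; apply: eq_bigr => t _.
  by rewrite cdfE quantile_law.
have m2box A' : (forall t, measurable (A' t)) ->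
    density_measure leb mwE w0E (box A') =
    \prod_t \int[lebesgue_measure]_(s in A' t) f t s.
  move=> mA'; rewrite /density_measure integral_mkcond.
  (* The indicator of a box is the product of the indicators of its sides, so the integrand is a
     product of functions of one coordinate each. *)
  transitivity (\int[leb]_x (\prod_t (\1_(A' t) (x t) * fine (f t (x t))))%:E).
    apply: eq_integral => x _; rewrite patchE big_split/=.
    case: ifPn => [/set_mem xA|/negP xA].
      rewrite big1 ?mul1r// => t _; rewrite indicE mem_set//; exact: xA.
    rewrite (_ : \prod_t _ = 0)%R ?mul0r//.
    have [t xt] : exists t, ~ A' t (x t).
      by apply/existsNP => xA'; apply: xA; rewrite inE.
    by rewrite (bigD1 t)//= indicE memNset// mul0r.
  rewrite (@ge0_integral_prod_lebesgue_ffun R T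
    (fun t s => \1_(A' t) s * fine (f t s))%R).
  - apply: eq_bigr => t _; rewrite -int_fine; last exact: mA'.
    rewrite [RHS]integral_mkcond; apply: eq_integral => s _.
    by rewrite patchE indicE; case: ifP; rewrite ?mul1r ?mul0r.
  - move=> t; apply: measurable_funM; first exact: measurable_indic.
    exact: (measurableT_comp (fine_measurable measurableT) (mf t)).
  - by move=> t s; rewrite mulr_ge0// fine_ge0.
apply: (@ffun_measure_unique R T m1 (density_measure leb mwE w0E)).
  move=> n; rewrite m1box//.
  rewrite -ge0_fin_numE; last by apply: prode_ge0 => t _; exact: integral_ge0.
  apply: prode_fin_num => t _; rewrite ge0_fin_numE ?integral_ge0//.
  apply: (@le_lt_trans _ _ 1); last exact: ltry.
  by rewrite -(f1 t); apply: ge0_subset_integral.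
by move=> A' mA'; rewrite m1box//; exact/esym/m2box.
Qed.

Let integral_quantile_transform (phi : {ffun T -> R} -> \bar R) :
  measurable_fun setT phi -> (forall x, 0 <= phi x) ->
  \int[leb]_u (phi (Qv u) * (\1_cube u)%:E) = \int[leb]_x (phi x * (w x)%:E).
Proof.
move=> mphi phi0.
transitivity (\int[pushforward
    (density_measure leb mcube_weight cube_weight0) Qv]_x phi x).
  rewrite [RHS]ge0_integral_pushforward// preimage_setT ge0_integral_density//.
  - exact: measurableT_comp.
  - by move=> u; exact: phi0.
transitivity (\int[density_measure leb mwE w0E]_x phi x); last first.
  exact: (ge0_integral_density leb mwE w0E mphi phi0).
by apply: eq_measure_integral => A mA _; exact: quantile_transform_law.
Qed.

Let copula_weight (u : {ffun T -> R}) : \bar R := (g (Qv u) * \1_cube u)%:E.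

Let mcopula_weight : measurable_fun setT copula_weight.
Proof.
apply/measurable_EFinP; apply: measurable_funM; last exact: measurable_indic.
exact: (measurableT_comp mg mQv).
Qed.

Let copula_weight0 u : 0 <= copula_weight u.
Proof. by rewrite lee_fin mulr_ge0. Qed.

(** Change of variables applied to the indicator of [D] times [g]. Any event of the cube that the
    quantile map matches with an event of [P] thereby gets its probability. *)
Let copula_weight_law (A D : set {ffun T -> R}) :
  measurable A -> measurable D ->
  (forall u, cube u -> A u <-> D [ffun t => Q t (u t)]) ->
  \int[leb]_(u in A) copula_weight u = P D.
Proof.
move=> mA mD AD; rewrite PE// [RHS]integral_mkcond.
transitivity (\int[leb]_x ((\1_D x * g x)%:E * (w x)%:E)); last first.
  apply: eq_integral => x _; rewrite patchE indicE.
  by case: ifP => _; rewrite ?mul1r ?mul0r ?mul0e.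
rewrite -(integral_quantile_transform (phi := fun x => (\1_D x * g x)%:E)).
- rewrite integral_mkcond; apply: eq_integral => u _.
  rewrite patchE /copula_weight -EFinM [\1_cube u]indicE.
  have [/set_mem u01|_] := boolP (u \in cube); last first.
    by rewrite !mulr0; case: ifP.
  rewrite !mulr1 indicE.
  have -> : Qv u = [ffun t => Q t (u t)].
    by apply/ffunP => t; rewrite !ffunE Q'E//; exact: u01.
  have [uA|uA] := boolP (u \in A).
    by rewrite mem_set ?mul1r//; apply/AD => //; exact: set_mem.
  by rewrite memNset ?mul0r// => /(AD _ u01)/mem_set; rewrite (negbTE uA).
- apply/measurable_EFinP; apply: measurable_funM => //; exact: measurable_indic.
- by move=> x; rewrite lee_fin mulr_ge0.
Qed.

(** Total mass, uniform margins and Sklar's identity are each [copula_weight_law] for a suitable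
    pair of events [A] and [D]. *)
Lemma copula_pdf_quantile : copula_pdf P (fun u =>
  let x : {ffun T -> R} := [ffun t => Q t (u t)] in
  (fine (k x) / \prod_t fine (f t (x t)))%R).
Proof.
have w1 : \int[leb]_u copula_weight u = 1.
  by rewrite (@copula_weight_law setT setT)//; exact: probability_setT.
have [C CE] := exists_density_probability mcopula_weight copula_weight0 w1.
have CP A D : measurable A -> measurable D ->
    (forall u, cube u -> A u <-> D [ffun t => Q t (u t)]) -> C A = P D.
  by move=> mA mD AD; rewrite CE; exact: copula_weight_law.
pose c (u : {ffun T -> R}) : R :=
  let x : {ffun T -> R} := [ffun t => Q t (u t)] in
  (fine (k x) / \prod_t fine (f t (x t)))%R.
have cE u : cube u -> (c u)%:E = copula_weight u.
  move=> u01; rewrite /copula_weight indicE mem_set// mulr1 /c /g /w.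
  have -> // : Qv u = [ffun t => Q t (u t)].
  by apply/ffunP => t; rewrite !ffunE Q'E//; exact: u01.
have Q_le t u y : (0 < u < 1)%R ->
    (Q t u <= y)%R = (u%:E <= marginal_cdf P t y).
  by move=> u01; rewrite cdfE (quantile_le (mf t) (f0 t) (f1 t) u01).
have FQ t u : (0 < u < 1)%R -> marginal_cdf P t (Q t u) = u%:E.
  by move=> u01; rewrite cdfE (density_cdf_quantile (mf t) (f0 t) (f1 t) u01).
have mle (a : T -> R) :
    measurable [set x : {ffun T -> R} | forall t, (x t <= a t)%R].
  apply: (@measurable_box _ T (fun t => [set s | (s <= a t)%R])) => t.
  rewrite (_ : [set _ | _] = `]-oo, a t]%classic); first exact: measurable_itv.
  by apply/seteqP; split=> s; rewrite /= in_itv.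
have mcoord t u :
    measurable ((fun x : {ffun T -> R} => x t) @^-1` `]-oo, u]%classic).
  by rewrite -[X in measurable X]setTI; exact: measurable_ffun_app.
exists C; first split.
(* The levels 0 and 1, where the quantile may be a default value, are treated apart: the event
   misses the cube or contains it. For 0 < u < 1, the event v t <= u is matched with x t <= Q t
   u. *)
- move=> t u /andP[]; rewrite le_eqVlt => /predU1P[<- _|u0].
    transitivity (P set0); last exact: measure0.
    apply: CP => // v v01.
    by split=> //; rewrite /= in_itv/= leNgt; have /andP[-> _] := v01 t.
  rewrite le_eqVlt => /predU1P[->|u1].
    transitivity (P setT); last exact: probability_setT.
    apply: CP => // v v01.
    by split=> // _; rewrite /= in_itv/= ltW//; have /andP[_ ->] := v01 t.
  have u01 : (0 < u < 1)%R by rewrite u0.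
  rewrite -[RHS](FQ t)//; apply: CP => [||v v01]; [exact: mcoord..|].
  by rewrite /= !in_itv/= ffunE Q_le ?FQ ?lee_fin//; exact: v01.
- move=> x; apply/esym/CP.
  + rewrite [X in measurable X](_ : _ =
        [set v : {ffun T -> R} |
          forall t, (v t <= fine (marginal_cdf P t (x t)))%R]).
      exact: mle.
    apply/seteqP; split=> v vx t; have := vx t;
      by rewrite -lee_fin fineK// cdfE
        (density_cdf_fin_num (mf t) (f0 t) (f1 t)).
  + exact: mle.
  + move=> u u01; split=> ux t.
      by rewrite ffunE Q_le//; exact: u01.
    by rewrite -Q_le; [have := ux t; rewrite ffunE|exact: u01].
- split; first split.
  + apply: (eq_measurable_fun copula_weight) => [u /set_mem/cE//|].
    exact: measurable_funTS.
  + by move=> u /cE ->.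
  + rewrite (eq_integral copula_weight) => [|u /set_mem/cE//].
    by rewrite -CE (CP cube setT)//; exact: probability_setT.
- move=> A mA; rewrite CE integral_mkcondr.
  apply: eq_integral => u _; rewrite patchE.
  case: ifPn => [/set_mem/cE//|ucube].
  by rewrite /copula_weight indicE (negbTE ucube) mulr0.
Qed.

End copula_density.

(** * Gluing vectors *)

Section glue.
Variables (R : realType) (d : nat).
Implicit Types I J A B C : {set 'I_d}.

(** With vectors extended by 0 to all of ['I_d], gluing becomes a test of membership, free of the
    subtypes [idx]. *)
Let ext A (x : {ffun idx A -> R}) (k : 'I_d) : R :=
  if insub k is Some i then x i else 0%R.

Let glueE A B (x : {ffun idx A -> R}) (y : {ffun idx B -> R}) (k : 'I_d) :
  glue_vec x y k =
  if k \in A then ext x k else if k \in B then ext y k else 0%R.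
Proof.
rewrite ffunE /ext; case: insubP => [i -> _|/negbTE ->]//.
by case: insubP => [j -> _|/negbTE ->].
Qed.

Let ext_subvec A (z : {ffun 'I_d -> R}) (k : 'I_d) : k \in A ->
  ext (subvec A z) k = z k.
Proof. by move=> kA; rewrite /ext insubT ffunE. Qed.

(** Both sides read their coordinates from [x] on [A], [y] on [B], [xJ] on [J] and [z] on [Z], in
    this order of priority. [C] and [W] are variables tied by equations, so that no dependent type
    has to be rewritten. *)
Lemma glue_vec_marginal A B C J W Z
    (x : {ffun idx A -> R}) (y : {ffun idx B -> R}) (xJ : {ffun idx J -> R})
    (z : {ffun idx Z -> R}) :
  C = A :|: B -> W = B :|: Z -> [disjoint B & J]%bool ->
  glue_vec (subvec (C :|: J) (glue_vec (subvec C (glue_vec x y)) xJ)) z =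
  glue_vec (subvec (A :|: J) (glue_vec x xJ)) (subvec W (glue_vec y z)).
Proof.
move=> hC hW dBJ; apply/ffunP => k; rewrite !glueE.
have CE : (k \in C) = (k \in A) || (k \in B) by rewrite hC finset.in_setU.
have WE : (k \in W) = (k \in B) || (k \in Z) by rewrite hW finset.in_setU.
have [kA|kA] := boolP (k \in A).
  have kCJ : k \in C :|: J by rewrite finset.in_setU CE kA.
  have kAJ : k \in A :|: J by rewrite finset.in_setU kA.
  rewrite kCJ kAJ !ext_subvec// !glueE kA.
  by rewrite CE kA ext_subvec ?CE ?kA// glueE kA.
have [kB|kB] := boolP (k \in B).
  have kJ := disjointFr dBJ kB.
  rewrite !finset.in_setU CE WE (negbTE kA) kB kJ/=.
  rewrite !ext_subvec ?finset.in_setU ?CE ?WE ?kB ?orbT// !glueE CE kB orbT.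
  by rewrite ext_subvec ?CE ?kB ?orbT// glueE (negbTE kA) kB.
rewrite !finset.in_setU CE WE (negbTE kA) (negbTE kB)/=.
have [kJ|kJ] := boolP (k \in J).
  rewrite !ext_subvec ?finset.in_setU ?kJ ?orbT// !glueE CE.
  by rewrite (negbTE kA) (negbTE kB) kJ.
have [kZ|//] := boolP (k \in Z).
by rewrite ext_subvec ?WE ?kZ ?orbT// glueE (negbTE kB) kZ.
Qed.

Lemma glue_vec_total I J W Z (x : {ffun idx I -> R}) (xJ : {ffun idx J -> R})
    (z : {ffun idx Z -> R}) : W = I :|: Z -> [disjoint I & J]%bool ->
  glue_vec xJ (subvec W (glue_vec x z)) =
  glue_vec (subvec (I :|: J) (glue_vec x xJ)) z.
Proof.
move=> hW dIJ; apply/ffunP => k; rewrite !glueE.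
have WE : (k \in W) = (k \in I) || (k \in Z) by rewrite hW finset.in_setU.
rewrite WE finset.in_setU.
have [kI|kI] := boolP (k \in I).
  rewrite (disjointFr dIJ kI)/= !ext_subvec ?WE ?finset.in_setU ?kI//.
  by rewrite !glueE kI.
have [kJ|kJ] := boolP (k \in J) => /=.
  by rewrite ext_subvec ?finset.in_setU ?kJ ?orbT// glueE (negbTE kI) kJ.
have [kZ|//] := boolP (k \in Z).
by rewrite ext_subvec ?WE ?kZ ?orbT// glueE (negbTE kI) kZ.
Qed.

Lemma measurable_subvec A : measurable_fun setT (@subvec R d A).
Proof.
apply: measurable_to_ffun => j.
rewrite (_ : (fun _ => _) = (fun x : {ffun 'I_d -> R} => x (val j))).
  exact: measurable_ffun_app.
by apply/funext => x; rewrite ffunE.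
Qed.

Lemma measurable_glue_vec A B : measurable_fun setT
  (fun p : {ffun idx A -> R} * {ffun idx B -> R} => glue_vec p.1 p.2).
Proof.
apply: measurable_to_ffun => k.
case kA : (insub k : option (idx A)) => [i|].
  rewrite (_ : (fun _ => _) = (fun x : {ffun idx A -> R} => x i) \o fst).
    by apply: measurableT_comp => //; exact: measurable_ffun_app.
  by apply/funext => p; rewrite /= ffunE kA.
case kB : (insub k : option (idx B)) => [j|].
  rewrite (_ : (fun _ => _) = (fun x : {ffun idx B -> R} => x j) \o snd).
    by apply: measurableT_comp => //; exact: measurable_ffun_app.
  by apply/funext => p; rewrite /= ffunE kA kB.
rewrite (_ : (fun _ => _) = cst 0%R)//.
by apply/funext => p; rewrite ffunE kA kB.
Qed.

Lemma measurable_glue_vecl A B (y : {ffun idx B -> R}) :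
  measurable_fun setT (fun x : {ffun idx A -> R} => glue_vec x y).
Proof.
exact: (measurableT_comp (@measurable_glue_vec A B)
  (measurable_fun_pair (@measurable_id _ _ setT) (measurable_cst y))).
Qed.

Lemma measurable_glue_vecr A B (x : {ffun idx A -> R}) :
  measurable_fun setT (fun y : {ffun idx B -> R} => glue_vec x y).
Proof.
exact: (measurableT_comp (@measurable_glue_vec A B)
  (measurable_fun_pair (measurable_cst x) (@measurable_id _ _ setT))).
Qed.

Lemma orthant_glue_vec A B (x : {ffun idx A -> R}) (y : {ffun idx B -> R}) :
  [disjoint A & B]%bool -> orthant (subvec (A :|: B) (glue_vec x y)) <->
  orthant x /\ orthant y.
Proof.
move=> dAB; split=> [xy0|[x0 y0] k].
  split=> [i|j].
    have iAB : val i \in A :|: B by rewrite finset.in_setU (valP i).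
    by have := xy0 (Sub (val i) iAB); rewrite ffunE SubK glue_vecL.
  have jAB : val j \in A :|: B by rewrite finset.in_setU (valP j) orbT.
  by have := xy0 (Sub (val j) jAB); rewrite ffunE SubK glue_vecR.
rewrite ffunE; have := valP k; rewrite finset.in_setU => /orP[kA|kB].
  by have := x0 (Sub (val k) kA); rewrite -(glue_vecL x y) SubK.
by have := y0 (Sub (val k) kB); rewrite -(glue_vecR x y _ dAB) SubK.
Qed.

Lemma ge0_integral_glue_vec A B C (f : {ffun idx C -> R} -> \bar R) :
  C = A :|: B -> [disjoint A & B]%bool ->
  measurable_fun setT f -> (forall z, 0 <= f z) ->
  \int[lebesgue_ffun R (idx C)]_z f z =
  \int[lebesgue_ffun R (idx A)]_x \int[lebesgue_ffun R (idx B)]_y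
    f (subvec C (glue_vec x y)).
Proof.
move=> hC dAB mf f0.
have inA (i : idx A) : val i \in C by rewrite hC finset.in_setU (valP i).
have inB (j : idx B) : val j \in C by rewrite hC finset.in_setU (valP j) orbT.
have inC k : k \in C -> k \in A \/ k \in B by rewrite hC finset.in_setU => /orP.
apply: (@ge0_integral_lebesgue_ffun R (idx C) (idx A) (idx B)
  (fun i => Sub (val i) (inA i)) (fun j => Sub (val j) (inB j))
  (fun p => subvec C (glue_vec p.1 p.2))) => //.
- by move=> i j /(congr1 val); rewrite !SubK => /val_inj.
- by move=> i j /(congr1 val); rewrite !SubK => /val_inj.
- move=> i j; apply/eqP => /(congr1 val); rewrite !SubK => ij.
  by have := disjointFr dAB (valP i); rewrite ij (valP j).
- move=> t; have [tA|tB] := inC _ (valP t).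
    by left; exists (Sub (val t) tA); apply/val_inj; rewrite !SubK.
  by right; exists (Sub (val t) tB); apply/val_inj; rewrite !SubK.
- by move=> x y i; rewrite ffunE SubK glue_vecL.
- by move=> x y j; rewrite ffunE SubK glue_vecR.
Qed.

End glue.

(** * Conditional densities *)

Lemma measurable_orthant (R : realType) (T : finType) :
  measurable (orthant : set {ffun T -> R}).
Proof.
apply: (@measurable_box R T (fun=> [set s | (0 < s)%R])) => t.
rewrite (_ : [set _ | _] = `]0%R, +oo[%classic); first exact: measurable_itv.
by apply/seteqP; split=> s; rewrite /= in_itv/= andbT.
Qed.

Section conditional_density.
Variables (R : realType) (d : nat) (r : {ffun 'I_d -> R} -> R).
Hypotheses (mr : measurable_fun orthant r)
  (r0 : forall x, orthant x -> (0 <= r x)%R).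
Implicit Types A B C I : {set 'I_d}.

(** Extension by 0 replaces integrals over orthants by integrals over whole spaces, where Tonelli's
    theorem is stated. *)
Let rho : {ffun 'I_d -> R} -> \bar R := (EFin \o r) \_ orthant.

Let mrho : measurable_fun setT rho.
Proof.
apply/(measurable_restrictT _ _).1; first exact: measurable_orthant.
exact/measurable_EFinP.
Qed.

Let rho0 x : 0 <= rho x.
Proof.
by rewrite /rho patchE; case: ifPn => // /set_mem x0; rewrite lee_fin r0.
Qed.

(* [margin r x] extended by [0] off the orthant. *)
Let M A (x : {ffun idx A -> R}) : \bar R :=
  \int[lebesgue_ffun R (idx (~: A))]_y rho (glue_vec x y).

Let orthant_glue A (x : {ffun idx A -> R}) (y : {ffun idx (~: A) -> R}) :
  orthant (glue_vec x y) <-> orthant x /\ orthant y.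
Proof.
have dA : [disjoint A & ~: A]%bool by rewrite -setI_eq0 finset.setICr.
split=> [xy0|/(orthant_glue_vec x y dA) xy0 k].
  by apply/(orthant_glue_vec x y dA) => k; rewrite ffunE; exact: xy0.
have kA : k \in A :|: ~: A by rewrite finset.setUCr finset.in_setT.
by have := xy0 (Sub k kA); rewrite ffunE SubK.
Qed.

Let ME A (x : {ffun idx A -> R}) : orthant x -> M x = margin r x.
Proof.
move=> x0; rewrite /M /margin [RHS]integral_mkcond; apply: eq_integral => y _.
rewrite /rho !patchE; have [/set_mem y0|y0] := boolP (y \in orthant).
  by rewrite mem_set//; apply/orthant_glue.
by rewrite memNset// => /orthant_glue[_ /mem_set]; exact/negP.
Qed.

Let M_off A (x : {ffun idx A -> R}) : ~ orthant x -> M x = 0.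
Proof.
move=> x0; apply: integral0_eq => y _; rewrite /rho patchE memNset//.
by move=> /orthant_glue[].
Qed.

Let M0 A (x : {ffun idx A -> R}) : 0 <= M x. Proof. exact: integral_ge0. Qed.

Let mM A : measurable_fun setT (@M A).
Proof.
apply: (@measurable_fun_fubini_tonelli_F _ _ _ _ _
  (lebesgue_ffun R (idx (~: A)))
  (fun p : {ffun idx A -> R} * {ffun idx (~: A) -> R} =>
    rho (glue_vec p.1 p.2))) => //.
exact: (measurableT_comp mrho (@measurable_glue_vec R d A (~: A))).
Qed.

Variables (J : {set 'I_d}) (xJ : {ffun idx J -> R}).
Hypotheses (xJ0 : orthant xJ) (rJ : 0 < margin r xJ < +oo).

(** A total version of [cond], with value 0 off the orthant when [A] and [J] are disjoint. The set
    [A] is free: [A = I] gives the joint density and singletons give the margins. *)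
Definition cond_ext A (x : {ffun idx A -> R}) : \bar R :=
  M (subvec (A :|: J) (glue_vec x xJ)) / margin r xJ.

Let rJ_inv0 : 0 <= (margin r xJ)^-1.
Proof. by rewrite inve_ge0; case/andP: rJ => /ltW. Qed.

Lemma measurable_cond_ext A : measurable_fun setT (@cond_ext A).
Proof.
apply: emeasurable_funM; last exact: measurable_cst.
apply: (measurableT_comp (@mM _)).
apply: (measurableT_comp (@measurable_subvec R d (A :|: J))).
exact: measurable_glue_vecl.
Qed.

Lemma cond_ext_ge0 A (x : {ffun idx A -> R}) : 0 <= cond_ext x.
Proof. exact: mule_ge0. Qed.

Lemma cond_extE A (x : {ffun idx A -> R}) : [disjoint A & J]%bool ->
  orthant x -> cond_ext x = cond r x xJ.
Proof. by move=> dAJ x0; rewrite /cond_ext ME//; apply/orthant_glue_vec. Qed.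

Lemma cond_ext_off A (x : {ffun idx A -> R}) : [disjoint A & J]%bool ->
  ~ orthant x -> cond_ext x = 0.
Proof.
move=> dAJ x0; rewrite /cond_ext M_off ?mul0e//.
by move=> /(orthant_glue_vec _ _ dAJ)[].
Qed.

(** The complement of A :|: J is the disjoint union of [B] and the complement of C :|: J, so by
    Tonelli integrating out the latter and then [B] amounts to integrating out the former. *)
Lemma cond_ext_marginal A B C (x : {ffun idx A -> R}) : C = A :|: B ->
  [disjoint A & B]%bool -> [disjoint B & J]%bool ->
  \int[lebesgue_ffun R (idx B)]_y cond_ext (subvec C (glue_vec x y)) =
  cond_ext x.
Proof.
move=> hC dAB dBJ; pose Z := ~: (C :|: J); pose W := ~: (A :|: J).
have hW : W = B :|: Z.
  apply/setP => k; rewrite /W /Z hC !finset.inE.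
  case: (boolP (k \in B)) => kB /=; last by rewrite orbF.
  by rewrite (disjointFl dAB kB) (disjointFr dBJ kB).
have dBZ : [disjoint B & Z]%bool.
  rewrite -setI_eq0; apply/eqP/setP => k; rewrite /Z hC !finset.inE.
  by case: (k \in B); rewrite ?orbT.
pose h (y : {ffun idx B -> R}) :=
  subvec (C :|: J) (glue_vec (subvec C (glue_vec x y)) xJ).
have mh : measurable_fun setT h.
  apply: (measurableT_comp (@measurable_subvec R d (C :|: J))).
  apply: (measurableT_comp (@measurable_glue_vecl R d C J xJ)).
  apply: (measurableT_comp (@measurable_subvec R d C)).
  exact: measurable_glue_vecr.
transitivity (\int[lebesgue_ffun R (idx B)]_y (M (h y) * (margin r xJ)^-1)).
  by [].
rewrite ge0_integralZr; [|exact: measurableT|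
  exact: (measurableT_comp (@mM _) mh)|by []|by []].
congr (_ / _); pose xAJ := subvec (A :|: J) (glue_vec x xJ).
have mxAJ : measurable_fun setT
    (fun z : {ffun idx W -> R} => rho (glue_vec xAJ z)).
  exact: (measurableT_comp mrho (@measurable_glue_vecr R d _ W xAJ)).
apply: esym; apply: (etrans (ge0_integral_glue_vec hW dBZ mxAJ (fun=> rho0 _))).
apply: eq_integral => y _; apply: eq_integral => z _.
by rewrite (glue_vec_marginal x y xJ z hC hW dBJ).
Qed.

Lemma integral_cond_ext I : [disjoint I & J]%bool ->
  \int[lebesgue_ffun R (idx I)]_x cond_ext x = 1.
Proof.
move=> dIJ; pose Z := ~: (I :|: J).
have hW : ~: J = I :|: Z.
  apply/setP => k; rewrite /Z !finset.inE.
  by case: (boolP (k \in I)) => //= kI; rewrite (disjointFr dIJ kI).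
have dIZ : [disjoint I & Z]%bool.
  rewrite -setI_eq0; apply/eqP/setP => k; rewrite /Z !finset.inE.
  by case: (k \in I).
pose h (x : {ffun idx I -> R}) := subvec (I :|: J) (glue_vec x xJ).
have mh : measurable_fun setT h.
  apply: (measurableT_comp (@measurable_subvec R d (I :|: J))).
  exact: measurable_glue_vecl.
transitivity (\int[lebesgue_ffun R (idx I)]_x (M (h x) * (margin r xJ)^-1)).
  by [].
rewrite ge0_integralZr; [|exact: measurableT|
  exact: (measurableT_comp (@mM _) mh)|by []|by []].
(* The complement of [J] splits into [I] and [Z], so the numerator integrates to [margin r xJ],
   which cancels because it is positive and finite. *)
rewrite (_ : \int[_]_x _ = margin r xJ).
  by rewrite divee//; case/andP: rJ => *; rewrite ?gt_eqF// ge0_fin_numE// ltW.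
rewrite -ME//.
have mxJ : measurable_fun setT
    (fun z : {ffun idx (~: J) -> R} => rho (glue_vec xJ z)).
  exact: (measurableT_comp mrho (@measurable_glue_vecr R d _ (~: J) xJ)).
apply: esym; apply: (etrans (ge0_integral_glue_vec hW dIZ mxJ (fun=> rho0 _))).
apply: eq_integral => x _; apply: eq_integral => z _.
by rewrite (glue_vec_total x xJ z hW dIJ).
Qed.

End conditional_density.

(** Needed because the formula with [cond_ext] is compared with [cond_copula_pdf] only on the cube,
    where the quantiles are positive. *)
Lemma eq_copula_pdf (R : realType) (T : finType)
    (P : probability {ffun T -> R} R) (c1 c2 : {ffun T -> R} -> R) :
  (forall u, open_cube u -> c1 u = c2 u) -> copula_pdf P c1 -> copula_pdf P c2.
Proof.
move=> c12 [C PC [[mc c0 cI] CE]]; exists C => //; split; first split.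
- by apply: eq_measurable_fun mc => u /set_mem/c12 ->.
- by move=> u u01; rewrite -c12//; exact: c0.
- by rewrite -cI; apply: eq_integral => u /set_mem/c12 ->.
- move=> A mA; rewrite CE//; apply: eq_integral => u /set_mem[_ u01].
  by rewrite c12.
Qed.

(** * Margins and copula of the conditional distribution *)

Section conditional_margins.
Variables (R : realType) (d : nat) (r : {ffun 'I_d -> R} -> R).
Hypotheses (mr : measurable_fun orthant r)
  (r0 : forall x, orthant x -> (0 <= r x)%R).
Variables (I J : {set 'I_d}) (xJ : {ffun idx J -> R}).
Hypotheses (dIJ : [disjoint I & J]%bool)
  (xJ0 : orthant xJ) (rJ : 0 < margin r xJ < +oo).

Let k : {ffun idx I -> R} -> \bar R := @cond_ext R d r J xJ I.

Let f (i : idx I) (s : measurableTypeR R) : \bar R :=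
  @cond_ext R d r J xJ [set val i]%SET [ffun=> s].

Let dJ (A : {set 'I_d}) : A \subset I -> [disjoint A & J]%bool.
Proof. by move=> /disjointWl; apply. Qed.

Let di (i : idx I) : [disjoint [set val i]%SET & J]%bool.
Proof. by apply: dJ; rewrite finset.sub1set (valP i). Qed.

Let dDi (i : idx I) : [disjoint I :\ val i & J]%bool.
Proof. by apply: dJ; exact: finset.subD1set. Qed.

Let dii (i : idx I) : [disjoint [set val i]%SET & I :\ val i]%bool.
Proof. by rewrite disjoints1 !finset.inE eqxx. Qed.

Let IE (i : idx I) : I = [set val i]%SET :|: (I :\ val i).
Proof. by rewrite finset.setD1K// (valP i). Qed.

Let mconst (A : {set 'I_d}) : measurable_fun setT
  (fun s : measurableTypeR R => [ffun=> s] : {ffun idx A -> R}).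
Proof.
apply: measurable_to_ffun => t.
rewrite (_ : (fun _ => _) = id); first exact: measurable_id.
by apply/funext => s; rewrite ffunE.
Qed.

Let mk : measurable_fun setT k.
Proof. exact: measurable_cond_ext. Qed.

Let mf i : measurable_fun setT (f i).
Proof.
exact: (measurableT_comp
  (@measurable_cond_ext R d r mr r0 J xJ [set val i]%SET) (@mconst _)).
Qed.

Let fE i s : (0 < s)%R -> f i s = cond1 r (val i) s xJ.
Proof. by move=> s0; rewrite /f cond_extE// => j; rewrite ffunE. Qed.

Let f_off i s : ~ (0 < s)%R -> f i s = 0.
Proof.
move=> s0; rewrite /f cond_ext_off// => /(_ (Sub (val i) (finset.set11 _))).
by rewrite ffunE.
Qed.

Let kE : k \_ orthant = k.
Proof.
apply/funext => x; rewrite patchE; case: ifPn => // x0.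
by rewrite /k cond_ext_off// => /mem_set; exact/negP.
Qed.

Let int_cond A : measurable A ->
  \int[lebesgue_ffun R (idx I)]_(x in A `&` orthant) cond r x xJ =
  \int[lebesgue_ffun R (idx I)]_(x in A) k x.
Proof.
move=> mA; rewrite -[in RHS]kE -integral_mkcondr.
apply: eq_integral => x /set_mem[_ x0].
by rewrite /k cond_extE.
Qed.

Let int_cond1 i (A : set (measurableTypeR R)) : measurable A ->
  \int[lebesgue_measure]_(s in A `&` `]0%R, +oo[) cond1 r (val i) s xJ =
  \int[lebesgue_measure]_(s in A) f i s.
Proof.
move=> mA.
rewrite [RHS](_ : _ = \int[lebesgue_measure]_(s in A) ((f i) \_ `]0%R, +oo[) s).
  rewrite -integral_mkcondr; apply: eq_integral => s /set_mem[_ /=].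
  by rewrite in_itv/= andbT => s0; rewrite fE.
apply: eq_integral => s _; rewrite patchE; case: ifPn => // s0.
by rewrite f_off// => h; move: s0; rewrite mem_set//= in_itv/= andbT.
Qed.

Lemma is_pdf_cond :
  is_pdf (lebesgue_ffun R (idx I)) orthant
    (fun xI : {ffun idx I -> R} => cond r xI xJ).
Proof.
have kcond x : orthant x -> k x = cond r x xJ by exact: cond_extE.
split.
- apply: (eq_measurable_fun k) => [x /set_mem/kcond//|].
  by apply: measurable_funTS; exact: mk.
- by move=> x /kcond <-; exact: cond_ext_ge0.
- by rewrite -[orthant]setTI int_cond// integral_cond_ext.
Qed.

(** This is [cond_ext_marginal] for the partition of [I] into [i] and the rest; restricting to the
    orthant loses nothing, as the extended density is 0 outside. *)
Lemma marginal_pdf_cond i t : (0 < t)%R ->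
  marginal_pdf (fun xI : {ffun idx I -> R} => cond r xI xJ) i t =
  cond1 r (val i) t xJ.
Proof.
move=> t0; rewrite -fE// /f.
rewrite -(cond_ext_marginal mr r0 rJ _ (IE i) (dii i) (dDi i)).
rewrite /marginal_pdf integral_mkcond; apply: eq_integral => y _.
have t0' : orthant ([ffun=> t] : {ffun idx [set val i]%SET -> R}).
  by move=> j; rewrite ffunE.
have := orthant_glue_vec [ffun=> t] y (dii i); rewrite -(IE i) => ty0.
rewrite patchE; case: ifPn => [/set_mem y0|y0].
  by rewrite cond_extE//; apply/ty0.
by rewrite cond_ext_off// => /ty0[_ /mem_set]; exact/negP.
Qed.

Variable P : probability {ffun idx I -> R} R.
Hypothesis PE : forall A, measurable A ->
  P A = \int[lebesgue_ffun R (idx I)]_(x in A) k x.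

(** Tonelli integrates the coordinates other than [i] first. The indicator of [A] depends only on
    the [i]-th coordinate and leaves the inner integral, which is then the marginal density. *)
Let marginalE i (A : set (measurableTypeR R)) : measurable A ->
  marginal P i A = \int[lebesgue_measure]_(s in A) f i s.
Proof.
move=> mA; have mAi : measurable [set x : {ffun idx I -> R} | A (x i)].
  have := measurable_ffun_app i measurableT (mA : measurable (A : set R)).
  by rewrite setTI.
transitivity (P [set x | A (x i)]) => //.
rewrite PE// integral_mkcond.
pose i0 : idx [set val i]%SET := Sub (val i) (finset.set11 _).
pose g (x : {ffun idx [set val i]%SET -> R}) : \bar R :=
  (\1_A (x i0))%:E * cond_ext r xJ x.
have mi0 : measurable_fun setT
    (fun x : {ffun idx [set val i]%SET -> R} => \1_A (x i0) : R).
  have mA' : measurable (A : set R) := mA.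
  exact: (measurableT_comp (@measurable_indic _ R R setT A mA')
    (measurable_ffun_app i0)).
have mg : measurable_fun setT g.
  apply: emeasurable_funM; first exact/measurable_EFinP.
  exact: measurable_cond_ext.
have g0 x : 0 <= g x.
  by apply: mule_ge0; rewrite ?lee_fin//; exact: cond_ext_ge0.
transitivity (\int[lebesgue_ffun R (idx [set val i]%SET)]_x g x).
  have mkA : measurable_fun setT (k \_ [set x : {ffun idx I -> R} | A (x i)]).
    by apply/(measurable_restrictT _ _).1 => //; exact: measurable_funTS.
  have kA0 z : 0 <= (k \_ [set x : {ffun idx I -> R} | A (x i)]) z.
    by rewrite patchE; case: ifP => // _; exact: cond_ext_ge0.
  apply: (etrans (ge0_integral_glue_vec (IE i) (dii i) mkA kA0)).
  apply: eq_integral => x _.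
  rewrite /g -(cond_ext_marginal mr r0 rJ _ (IE i) (dii i) (dDi i)).
  pose h (y : {ffun idx (I :\ val i) -> R}) : \bar R :=
    k (subvec I (glue_vec x y)).
  have mh : measurable_fun setT h.
    apply: (measurableT_comp mk).
    apply: (measurableT_comp (@measurable_subvec R d I)).
    exact: measurable_glue_vecr.
  have h0 y : setT y -> 0 <= h y by move=> _; exact: cond_ext_ge0.
  have c0 : 0 <= (\1_A (x i0) : R)%:E by rewrite lee_fin.
  apply: (etrans _ (ge0_integralZl (lebesgue_ffun R _) measurableT mh h0 c0)).
  apply: eq_integral => y _; rewrite patchE indicE.
  have -> : (subvec I (glue_vec x y) \in
      [set x : {ffun idx I -> R} | A (x i)]) = (x i0 \in A).
    have xi : subvec I (glue_vec x y) i = x i0.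
      by rewrite -(glue_vecL x y i0) SubK ffunE.
    by apply/idP/idP => /set_mem h'; apply/mem_set; move: h'; rewrite /= xi.
  by case: ifP; rewrite ?mul1e ?mul0e.
rewrite ge0_integral_lebesgue_ffun1//; last first.
  by rewrite card_sig (eq_card (B := [set val i]%SET))// finset.cards1.
rewrite [RHS]integral_mkcond; apply: eq_integral => s _.
rewrite /g ffunE patchE indicE.
by case: ifP; rewrite ?mul1e ?mul0e.
Qed.

Lemma has_pdf_cond :
  has_pdf P (lebesgue_ffun R (idx I)) orthant
    (fun xI : {ffun idx I -> R} => cond r xI xJ).
Proof.
split=> [|A mA]; first exact: is_pdf_cond.
exact: (etrans (PE mA) (esym (int_cond mA))).
Qed.

Lemma has_pdf_marginal i :
  has_pdf (marginal P i) lebesgue_measure `]0%R, +oo[%classic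
    (fun t => cond1 r (val i) t xJ).
Proof.
have fcond s : `]0%R, +oo[%classic s -> f i s = cond1 r (val i) s xJ.
  by rewrite /= in_itv/= andbT; exact: fE.
split=> [|A mA]; last exact: (etrans (marginalE i mA) (esym (int_cond1 i mA))).
split.
- apply: (eq_measurable_fun (f i)) => [s /set_mem/fcond//|].
  by apply: measurable_funTS; exact: mf.
- by move=> s /fcond <-; exact: (cond_ext_ge0 r0 rJ).
- rewrite -[`]0%R, +oo[%classic]setTI.
  apply: (etrans (int_cond1 i measurableT)).
  by apply: (etrans (esym (marginalE i measurableT))); exact: probability_setT.
Qed.

Lemma marginal_cdf_cond i t : marginal_cdf P i t = cond_cdf r (val i) t xJ.
Proof.
apply: (etrans (marginalE i (measurable_itv `]-oo, t]))).
apply: (etrans (esym (int_cond1 i (measurable_itv `]-oo, t])))).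
congr (integral _ _ _).
apply/seteqP; split=> s; rewrite /= !in_itv/= andbT.
  by move=> [-> ->].
by move=> /andP[-> ->].
Qed.

Lemma copula_pdf_cond : copula_pdf P (fun u => cond_copula_pdf r u xJ).
Proof.
have := copula_pdf_quantile mk (cond_ext_ge0 r0 rJ (A := I)) PE mf
  (fun i s => cond_ext_ge0 r0 rJ _) marginalE.
apply: eq_copula_pdf => u u01.
have QE i : quantile (marginal_cdf P i) (u i) =
    cond_quantile r (val i) (u i) xJ.
  rewrite /cond_quantile; congr quantile; apply/funext => t.
  exact: marginal_cdf_cond.
have f1 i : \int[lebesgue_measure]_s f i s = 1.
  by apply: (etrans (esym (marginalE i measurableT))); exact: probability_setT.
(* The density is 0 on the negative half-line, so the distribution function is 0 < u at 0. Hence the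
   quantile vector lies in the orthant, where [cond_ext] agrees with [cond]. *)
have Q0 i : (0 < cond_quantile r (val i) (u i) xJ)%R.
  rewrite -QE ltNge.
  have -> : marginal_cdf P i =
      fun y => \int[lebesgue_measure]_(s in `]-oo, y]) f i s.
    by apply/funext => y; exact: (marginalE i (measurable_itv `]-oo, y])).
  rewrite (quantile_le (mf i) (fun s => cond_ext_ge0 r0 rJ _) (f1 i) (u01 i)).
  rewrite integral0_eq; first by rewrite -ltNge lte_fin; case/andP: (u01 i).
  by move=> s /=; rewrite in_itv/= leNgt => /negP; exact: f_off.
pose x : {ffun idx I -> R} := [ffun i => cond_quantile r (val i) (u i) xJ].
have xE : [ffun i => quantile (marginal_cdf P i) (u i)] = x.
  by apply/ffunP => i; rewrite !ffunE QE.
have x0 : orthant x by move=> i; rewrite ffunE.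
rewrite /cond_copula_pdf /= xE -/x /k cond_extE//; congr (_ / _)%R.
by apply: eq_bigr => i _; rewrite fE.
Qed.

End conditional_margins.

Theorem proposition3p1 (R : realType) (d : nat)
    (r : {ffun 'I_d -> R} -> R) (I J : {set 'I_d})
    (xJ : {ffun idx J -> R}) :
  tail_copula_density r ->
  I != finset.set0 -> J != finset.set0 -> [disjoint I & J]%bool ->
  orthant xJ -> 0 < margin r xJ < +oo ->
  is_pdf (lebesgue_ffun R (idx I)) orthant (fun xI => cond r xI xJ) /\
  exists P : probability {ffun idx I -> R} R,
    [/\ has_pdf P (lebesgue_ffun R (idx I)) orthant (fun xI => cond r xI xJ),
        forall i : idx I,
          [/\ forall t : R, (0 < t)%R ->
                marginal_pdf (fun xI => cond r xI xJ) i t =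
                cond1 r (val i) t xJ,
              has_pdf (marginal P i) lebesgue_measure `]0%R, +oo[%classic
                (fun t => cond1 r (val i) t xJ),
              forall t : R,
                marginal_cdf P i t = cond_cdf r (val i) t xJ &
              forall u : R, (0 < u < 1)%R ->
                quantile (marginal_cdf P i) u = cond_quantile r (val i) u xJ] &
        (2 <= #|I|)%N -> copula_pdf P (fun u => cond_copula_pdf r u xJ)].
Proof.
move=> [mr r0 _ _] _ _ dIJ xJ0 rJ.
split; first exact: is_pdf_cond.
have [P PE] := exists_density_probability
  (@measurable_cond_ext R d r mr r0 J xJ I)
  (cond_ext_ge0 r0 rJ (A := I)) (integral_cond_ext mr r0 xJ0 rJ dIJ).
exists P; split=> [|i|_].
- by apply: has_pdf_cond => // A _; exact: PE.
- have cdfE t : marginal_cdf P i t = cond_cdf r (val i) t xJ.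
    by apply: marginal_cdf_cond => // A _; exact: PE.
  split=> //.
  + exact: marginal_pdf_cond.
  + by apply: has_pdf_marginal => // A _; exact: PE.
  + by move=> u _; rewrite /cond_quantile; congr quantile; exact/funext.
- by apply: copula_pdf_cond => // A _; exact: PE.
Qed.
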